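(* Let $\mathbb T=\{z\in\mathbb C:|z|=1\}$. (1) The left universal lifts for $\otimes$ are exactly the members of the one-parameter family $\{\lambda^\gamma\}_{\gamma\in\mathbb T\cup\{0\}}$, and the right universal lifts for $\otimes$ are exactly the members of the one-parameter family $\{\rho^\gamma\}_{\gamma\in\mathbb T\cup\{0\}}$, where $$\lambda^\gamma_{H_1,H_2}(X)=X\otimes P_\Omega+X_\gamma\otimes P_{\Omega^\perp},\qquad \rho^\gamma_{H_1,H_2}(Y)=P_\Omega\otimes Y+P_{\Omega^\perp}\otimes Y_\gamma$$ for $X\in L_{\mathrm a}(H_1)$ and $Y\in L_{\mathrm a}(H_2)$. (2) The universal lifts for $\otimes$ are exactly the pairs in the family $\{(\lambda^\gamma,\rho^\delta)\}_{(\gamma,\delta)\in J_\otimes}$, where $$J_\otimes=\{(\gamma,\delta)\in(\mathbb T\cup\{0\})^2:\ \gamma=\delta\ \text{or}\ \gamma=0\ \text{or}\ \delta=0\}.$$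
   Context: Pre-Hilbert spaces. All pre-Hilbert spaces are complex, with inner product linear in the second argument, and equipped with a distinguished unit vector, always denoted $\Omega$; $\hat H=H\ominus\mathbb C\Omega$. $L_{\mathrm a}(H)$ is the $\ast$-algebra of adjointable linear operators on $H$. $P_\Omega$ is the orthogonal projection onto $\mathbb C\Omega$ and $P_{\Omega^\perp}=\mathrm{id}-P_\Omega$. An arrow $W\colon H\to G$ is a (possibly non-adjointable) linear isometry with $W\Omega=\Omega$. Tensor product. $H_1\otimes H_2$ is the algebraic tensor product with distinguished unit vector $\Omega=\Omega\otimes\Omega$; $H_1$ and $H_2$ are regarded as subspaces via $x\mapsto x\otimes\Omega$ and $y\mapsto\Omega\otimes y$; the usual associativity identification is used. The map $T\mapsto T_\gamma$. With respect to $H=\mathbb C\Omega\oplus\hat H$ write $T\in L_{\mathrm a}(H)$ as $T=\begin{pmatrix}\tau&(t')^*\\ t&\hat T\end{pmatrix}$ with $\tau\in\mathbb C$, $t,t'\in\hat H$, $\hat T\in L_{\mathrm a}(\hat H)$, where $(t')^*$ denotes $h\mapsto\langle t',h\rangle$. Then $T_\gamma:=\begin{pmatrix}|\gamma|\tau&(\gamma t')^*\\ \gamma t&|\gamma|\hat T\end{pmatrix}$. Universal lifts for $\otimes$. A left universal lift is a family of $\ast$-homomorphisms $\lambda_{H_1,H_2}\colon L_{\mathrm a}(H_1)\to L_{\mathrm a}(H_1\otimes H_2)$ (for all pre-Hilbert spaces $H_1,H_2$) such that: (left associativity) $\lambda_{H_1,H_2\otimes H_3}=\lambda_{H_1\otimes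 H_2,H_3}\circ\lambda_{H_1,H_2}$; (left universality of pre-Hilbert spaces) for all $T\in L_{\mathrm a}(H_1)$, $S\in L_{\mathrm a}(G_1)$ and arrows $W_k\colon H_k\to G_k$ ($k=1,2$) with $W_1T=SW_1$ and $W_1T^*=S^*W_1$, one has $(W_1\otimes W_2)\lambda_{H_1,H_2}(T)=\lambda_{G_1,G_2}(S)(W_1\otimes W_2)$; (left restriction) $\lambda_{H_1,H_2}(T)|_{H_1}=T$. A right universal lift is a family of $\ast$-homomorphisms $\rho_{H_1,H_2}\colon L_{\mathrm a}(H_2)\to L_{\mathrm a}(H_1\otimes H_2)$ satisfying the mirror-image axioms: $\rho_{H_1\otimes H_2,H_3}=\rho_{H_1,H_2\otimes H_3}\circ\rho_{H_2,H_3}$; if $T\in L_{\mathrm a}(H_2)$, $S\in L_{\mathrm a}(G_2)$, $W_2T=SW_2$, $W_2T^*=S^*W_2$, then $(W_1\otimes W_2)\rho_{H_1,H_2}(T)=\rho_{G_1,G_2}(S)(W_1\otimes W_2)$; and $\rho_{H_1,H_2}(T)|_{H_2}=T$. A universal lift is a pair $(\lambda,\rho)$ of a left and a right universal lift satisfying (middle associativity) $\rho_{H_1,H_2\otimes H_3}\circ\lambda_{H_2,H_3}=\lambda_{H_1\otimes H_2,H_3}\circ\rho_{H_1,H_2}$ for all $H_1,H_2,H_3$. *)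

(* Defs.v *)
From HB Require Import structures.
From mathcomp Require Import all_boot all_order all_algebra.
From mathcomp Require Import ring complex.
From mathcomp Require Import boolp classical_sets reals.

Set Implicit Arguments.
Unset Strict Implicit.
Unset Printing Implicit Defensive.

Import Order.TTheory GRing.Theory Num.Theory.

Local Open Scope ring_scope.

Reserved Notation "''[' x , y ]" (format "''[' x ,  y ]").
Reserved Notation "x ⊗ y" (at level 40, left associativity).
Reserved Notation "T ^†" (format "T ^†").

HB.mixin Record isPreHilbert (C : numClosedFieldType) V
    of GRing.Lmodule C V := {
  inner : V -> V -> C;
  Omega : V;
  inner_scalar : forall x, scalar (inner x);
  inner_conj : forall x y, inner y x = (inner x y)^*;
  inner_gt0 : forall x, x != 0 -> 0 < inner x x;
  inner_Omega : inner Omega Omega = 1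
}.

#[short(type="preHilbertType")]
HB.structure Definition PreHilbert (C : numClosedFieldType) :=
  {V of isPreHilbert C V & GRing.Lmodule C V}.

Arguments Omega {C s}.
Notation "''[' x , y ]" := (inner x y) : ring_scope.

Section InnerTheory.
Context {C : numClosedFieldType} {H : preHilbertType C}.
Implicit Types (x y z : H) (a : C).

HB.instance Definition _ x :=
  GRing.isLinear.Build C H C *%R (inner x) (inner_scalar x).

Lemma innerDr x y z : '[x, y + z] = '[x, y] + '[x, z].
Proof. exact: raddfD. Qed.
Lemma innerBr x y z : '[x, y - z] = '[x, y] - '[x, z].
Proof. exact: raddfB. Qed.
Lemma innerZr a x y : '[x, a *: y] = a * '[x, y].
Proof. exact: linearZ. Qed.
Lemma inner0r x : '[x, 0] = 0.
Proof. exact: raddf0. Qed.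
Lemma innerNr x y : '[x, - y] = - '[x, y].
Proof. exact: raddfN. Qed.
Lemma inner_sumr x I (r : seq I) (P : pred I) (F : I -> H) :
  '[x, \sum_(i <- r | P i) F i] = \sum_(i <- r | P i) '[x, F i].
Proof. exact: raddf_sum. Qed.
Lemma innerDl x y z : '[x + y, z] = '[x, z] + '[y, z].
Proof. by rewrite inner_conj innerDr rmorphD /= -!inner_conj. Qed.
Lemma innerNl x y : '[- x, y] = - '[x, y].
Proof. by rewrite inner_conj innerNr rmorphN /= -!inner_conj. Qed.
Lemma innerBl x y z : '[x - y, z] = '[x, z] - '[y, z].
Proof. by rewrite innerDl innerNl. Qed.
Lemma innerZl a x y : '[a *: x, y] = a^* * '[x, y].
Proof. by rewrite inner_conj innerZr rmorphM /= -inner_conj. Qed.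
Lemma inner0l x : '[0, x] = 0.
Proof. by rewrite inner_conj inner0r conjC0. Qed.
Lemma inner_suml x I (r : seq I) (P : pred I) (F : I -> H) :
  '[\sum_(i <- r | P i) F i, x] = \sum_(i <- r | P i) '[F i, x].
Proof.
rewrite inner_conj inner_sumr rmorph_sum /=.
by apply: eq_bigr => i _; rewrite -inner_conj.
Qed.

Lemma inner_ge0 x : 0 <= '[x, x].
Proof.
by have [->|/inner_gt0/ltW//] := eqVneq x 0; rewrite inner0r.
Qed.

Lemma inner_eq0 x : ('[x, x] == 0) = (x == 0).
Proof.
have [->|/inner_gt0] := eqVneq x 0; first by rewrite inner0r eqxx.
by rewrite lt0r => /andP[/negPf].
Qed.

Lemma inner_inj x y : (forall z, '[z, x] = '[z, y]) -> x = y.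
Proof.
move=> h; apply/eqP; rewrite -subr_eq0 -inner_eq0 innerBr h subrr; exact: eqxx.
Qed.

Lemma inner_injl x y : (forall z, '[x, z] = '[y, z]) -> x = y.
Proof.
by move=> h; apply: inner_inj => z; rewrite inner_conj h -inner_conj.
Qed.

End InnerTheory.

Definition is_arrow {C : numClosedFieldType} {H G : preHilbertType C}
    (W : {linear H -> G}) : Prop :=
  (forall x y, '[W x, W y] = '[x, y]) /\ W Omega = Omega.

Section AdjointableOperators.
Context {C : numClosedFieldType} (H : preHilbertType C).

Record adjop := AdjOp {
  adjop_fun :> H -> H;
  adjop_linear : linear adjop_fun;
  adjop_adjointable :
    exists T' : H -> H, forall x y, '[T' x, y] = '[x, adjop_fun y]
}.

HB.instance Definition _ (T : adjop) :=
  GRing.isLinear.Build C H H *:%R (adjop_fun T) (adjop_linear T).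

HB.instance Definition _ := gen_eqMixin adjop.
HB.instance Definition _ := gen_choiceMixin adjop.

Lemma adjop_eq (S T : adjop) : S =1 T -> S = T.
Proof.
case: S T => [S sl sa] [T tl ta] /= /funext eqST.
by move: sl sa; rewrite eqST => sl sa; congr AdjOp; apply: Prop_irrelevance.
Qed.

Lemma adjoint_linear (S S' : H -> H) :
  (forall x y, '[S' x, y] = '[x, S y]) -> linear S'.
Proof.
move=> h a x y; apply: inner_injl => z.
by rewrite h !(innerDl, innerZl) !h.
Qed.

Definition adj_fun (T : adjop) : H -> H :=
  sval (cid (adjop_adjointable T)).

Lemma adj_funP (T : adjop) x y : '[adj_fun T x, y] = '[x, T y].
Proof. exact: (svalP (cid (adjop_adjointable T))). Qed.

Lemma adj_fun_adjointable (T : adjop) :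
  exists T' : H -> H, forall x y, '[T' x, y] = '[x, adj_fun T y].
Proof.
by exists T => x y; rewrite inner_conj -adj_funP -inner_conj.
Qed.

Definition adj (T : adjop) : adjop :=
  AdjOp (adjoint_linear (adj_funP T)) (adj_fun_adjointable T).

Lemma adjP (T : adjop) x y : '[adj T x, y] = '[x, T y].
Proof. exact: adj_funP. Qed.

Lemma adj_unique (S T : adjop) :
  (forall x y, '[S x, y] = '[x, T y]) -> adj T = S.
Proof.
by move=> h; apply: adjop_eq => x; apply: inner_injl => y; rewrite adjP h.
Qed.

Lemma adjK : involutive adj.
Proof.
by move=> T; apply: adj_unique => x y; rewrite inner_conj -adjP -inner_conj.
Qed.

Lemma zero_op_linear : linear (fun _ : H => 0 : H).
Proof. by move=> a x y; rewrite scaler0 addr0. Qed.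
Lemma zero_op_adj :
  exists T' : H -> H, forall x y, '[T' x, y] = '[x, (0 : H)].
Proof. by exists (fun=> 0) => x y; rewrite inner0l inner0r. Qed.
Definition zero_op := AdjOp zero_op_linear zero_op_adj.

Lemma one_op_linear : linear (fun x : H => x).
Proof. by []. Qed.
Lemma one_op_adj : exists T' : H -> H, forall x y, '[T' x, y] = '[x, y].
Proof. by exists id. Qed.
Definition one_op := AdjOp one_op_linear one_op_adj.

Lemma opp_op_linear (T : adjop) : linear (fun x => - T x).
Proof. by move=> a x y; rewrite linearP opprD scalerN. Qed.
Lemma opp_op_adj (T : adjop) :
  exists T' : H -> H, forall x y, '[T' x, y] = '[x, - T y].
Proof. by exists (fun x => - adj T x) => x y; rewrite innerNl innerNr adjP. Qed.
Definition opp_op T := AdjOp (opp_op_linear T) (opp_op_adj T).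

Lemma add_op_linear (S T : adjop) : linear (fun x => S x + T x).
Proof. by move=> a x y; rewrite !linearP scalerDr addrACA. Qed.
Lemma add_op_adj (S T : adjop) :
  exists T' : H -> H, forall x y, '[T' x, y] = '[x, S y + T y].
Proof.
by exists (fun x => adj S x + adj T x) => x y; rewrite innerDl innerDr !adjP.
Qed.
Definition add_op S T := AdjOp (add_op_linear S T) (add_op_adj S T).

Lemma scale_op_linear (a : C) (T : adjop) : linear (fun x => a *: T x).
Proof. by move=> b x y; rewrite linearP scalerDr !scalerA mulrC. Qed.
Lemma scale_op_adj (a : C) (T : adjop) :
  exists T' : H -> H, forall x y, '[T' x, y] = '[x, a *: T y].
Proof.
by exists (fun x => a^* *: adj T x) => x y; rewrite innerZl innerZr adjP conjCK.
Qed.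
Definition scale_op a T := AdjOp (scale_op_linear a T) (scale_op_adj a T).

Lemma mul_op_linear (S T : adjop) : linear (fun x => S (T x)).
Proof. by move=> a x y; rewrite !linearP. Qed.
Lemma mul_op_adj (S T : adjop) :
  exists T' : H -> H, forall x y, '[T' x, y] = '[x, S (T y)].
Proof. by exists (fun x => adj T (adj S x)) => x y; rewrite !adjP. Qed.
Definition mul_op S T := AdjOp (mul_op_linear S T) (mul_op_adj S T).

Lemma add_opA : associative add_op.
Proof. by move=> S T U; apply: adjop_eq => x /=; rewrite addrA. Qed.
Lemma add_opC : commutative add_op.
Proof. by move=> S T; apply: adjop_eq => x /=; rewrite addrC. Qed.
Lemma add_op0 : left_id zero_op add_op.
Proof. by move=> S; apply: adjop_eq => x /=; rewrite add0r. Qed.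
Lemma add_opN : left_inverse zero_op opp_op add_op.
Proof. by move=> S; apply: adjop_eq => x /=; rewrite addNr. Qed.

HB.instance Definition _ :=
  GRing.isZmodule.Build adjop add_opA add_opC add_op0 add_opN.

Lemma mul_opA : associative mul_op.
Proof. by move=> S T U; apply: adjop_eq. Qed.
Lemma mul_1op : left_id one_op mul_op.
Proof. by move=> S; apply: adjop_eq. Qed.
Lemma mul_op1 : right_id one_op mul_op.
Proof. by move=> S; apply: adjop_eq. Qed.
Lemma mul_opDl : left_distributive mul_op +%R.
Proof. by move=> S T U; apply: adjop_eq. Qed.
Lemma mul_opDr : right_distributive mul_op +%R.
Proof. by move=> S T U; apply: adjop_eq => x /=; rewrite linearD. Qed.
Lemma one_op_neq0 : one_op != 0.
Proof.
apply/eqP => /(congr1 (fun T : adjop => '[Omega, T Omega])) /=.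
by rewrite inner_Omega inner0r => /eqP; rewrite oner_eq0.
Qed.

HB.instance Definition _ := GRing.Zmodule_isNzRing.Build adjop
  mul_opA mul_1op mul_op1 mul_opDl mul_opDr one_op_neq0.

Lemma scale_opA a b T : scale_op a (scale_op b T) = scale_op (a * b) T.
Proof. by apply: adjop_eq => x /=; rewrite scalerA. Qed.
Lemma scale_1op : left_id 1 scale_op.
Proof. by move=> T; apply: adjop_eq => x /=; rewrite scale1r. Qed.
Lemma scale_opDr : right_distributive scale_op +%R.
Proof. by move=> a S T; apply: adjop_eq => x /=; rewrite scalerDr. Qed.
Lemma scale_opDl T : {morph scale_op^~ T : a b / a + b}.
Proof. by move=> a b; apply: adjop_eq => x /=; rewrite scalerDl. Qed.

HB.instance Definition _ := GRing.Zmodule_isLmodule.Build C adjop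
  scale_opA scale_1op scale_opDr scale_opDl.

Lemma scale_opAl (a : C) (S T : adjop) : a *: (S * T) = a *: S * T.
Proof. exact: adjop_eq. Qed.
HB.instance Definition _ := GRing.Lmodule_isLalgebra.Build C adjop scale_opAl.

Lemma scale_opAr (a : C) (S T : adjop) : a *: (S * T) = S * (a *: T).
Proof. apply: adjop_eq => x; change (a *: S (T x) = S (a *: T x)).
by rewrite linearZ. Qed.
HB.instance Definition _ := GRing.Lalgebra_isAlgebra.Build C adjop scale_opAr.

Lemma adjopDE (S T : adjop) x : (S + T) x = S x + T x.
Proof. by []. Qed.
Lemma adjopNE (T : adjop) x : (- T) x = - T x.
Proof. by []. Qed.
Lemma adjopBE (S T : adjop) x : (S - T) x = S x - T x.
Proof. by []. Qed.
Lemma adjopZE a (T : adjop) x : (a *: T) x = a *: T x.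
Proof. by []. Qed.
Lemma adjopME (S T : adjop) x : (S * T) x = S (T x).
Proof. by []. Qed.
Lemma adjop1E x : (1 : adjop) x = x.
Proof. by []. Qed.
Lemma adjop0E x : (0 : adjop) x = 0.
Proof. by []. Qed.
Definition adjopE := (adjopDE, adjopBE, adjopNE, adjopZE, adjopME, adjop1E,
  adjop0E).

(* [ketbra u v] is the rank-one operator [h |-> <v, h> u]. *)
Lemma ketbra_linear (u v : H) : linear (fun h => '[v, h] *: u).
Proof. by move=> a x y; rewrite innerDr innerZr scalerDl scalerA. Qed.
Lemma ketbra_adj (u v : H) :
  exists T' : H -> H, forall x y, '[T' x, y] = '[x, '[v, y] *: u].
Proof.
exists (fun h => '[u, h] *: v) => x y.
by rewrite innerZl innerZr -inner_conj mulrC.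
Qed.
Definition ketbra u v : adjop := AdjOp (ketbra_linear u v) (ketbra_adj u v).

Definition P_Omega : adjop := ketbra Omega Omega.
Definition P_perp : adjop := 1 - P_Omega.

End AdjointableOperators.

Arguments adj {C H} T.
Arguments P_Omega {C H}.
Arguments P_perp {C H}.
Notation "T ^†" := (adj T) : ring_scope.

(* *-homomorphisms are not required to preserve the unit. *)
Definition star_hom {C : numClosedFieldType} {H G : preHilbertType C}
    (f : adjop H -> adjop G) : Prop :=
  [/\ linear f, {morph f : S T / S * T} & {morph f : T / T^†}].

Section Twist.
Context {C : numClosedFieldType} {H : preHilbertType C}.
Implicit Types T : adjop H.

(* The operator with block matrix [[a, <v, .>], [u, K]] with respect to the
   decomposition of H into the line of Omega and its orthogonal complement,
   when u and v are orthogonal to Omega and K = P_perp K P_perp. *)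
Definition block_op (a : C) (u v : H) (K : adjop H) : adjop H :=
  a *: P_Omega + ketbra Omega v + ketbra u Omega + K.

Definition block_tau T : C := '[Omega, T Omega].
Definition block_t T : H := P_perp (T Omega).
Definition block_t' T : H := P_perp (T^† Omega).
Definition block_hat T : adjop H := P_perp * T * P_perp.

Lemma P_perp_sa : (P_perp : adjop H)^† = P_perp.
Proof.
apply: adj_unique => x y.
rewrite /P_perp !adjopE /= innerBl innerBr innerZl innerZr.
by rewrite -inner_conj mulrC.
Qed.

Lemma block_opE T :
  T = block_op (block_tau T) (block_t T) (block_t' T) (block_hat T).
Proof.
have EPP : block_tau T *: P_Omega = P_Omega * T * P_Omega.
  apply: adjop_eq => x; rewrite !adjopE /= [T _]linearZ innerZr !scalerA.
  by rewrite mulrC.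
have EQP : ketbra (block_t T) Omega = P_perp * T * P_Omega.
  apply: adjop_eq => x; rewrite !adjopME.
  by rewrite [P_Omega x]/('[_, _] *: _) [T _]linearZ [P_perp _]linearZ.
have EPQ : ketbra Omega (block_t' T) = P_Omega * T * P_perp.
  apply: adjop_eq => x; rewrite !adjopME /=; congr (_ *: _).
  by rewrite /block_t' -{1}P_perp_sa !adjP.
have PQ1 : P_Omega + P_perp = 1 :> adjop H by rewrite addrC subrK.
rewrite /block_op EPP EQP EPQ /block_hat -mulrDr -addrA -mulrDr PQ1 !mulr1.
by rewrite -mulrDl PQ1 mul1r.
Qed.

Definition twist (g : C) T : adjop H :=
  block_op (`|g| * block_tau T) (g *: block_t T) (g *: block_t' T)
    (`|g| *: block_hat T).

End Twist.

Section TensorForms.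
Context {C : numClosedFieldType} {H1 H2 : preHilbertType C}.
Implicit Types (s t : seq (H1 * H2)).

Definition form_of s (x : H1) (y : H2) : C :=
  \sum_(p <- s) '[x, p.1] * '[y, p.2].

Definition form_eval s t : C := \sum_(p <- s) form_of t p.1 p.2.

Lemma form_of_cons p s x y :
  form_of (p :: s) x y = '[x, p.1] * '[y, p.2] + form_of s x y.
Proof. by rewrite /form_of big_cons. Qed.

Lemma form_of_cat s t x y :
  form_of (s ++ t) x y = form_of s x y + form_of t x y.
Proof. by rewrite /form_of big_cat. Qed.

Lemma form_of_scale a s x y :
  form_of [seq (a *: p.1, p.2) | p <- s] x y = a * form_of s x y.
Proof.
rewrite /form_of big_map mulr_sumr; apply: eq_bigr => p _ /=.
by rewrite innerZr mulrA.
Qed.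

Lemma form_eval_conj s t : form_eval t s = (form_eval s t)^*.
Proof.
rewrite /form_eval rmorph_sum /= exchange_big /=; apply: eq_bigr => p _.
rewrite /form_of rmorph_sum; apply: eq_bigr => q _ /=.
by rewrite rmorphM /= -!inner_conj.
Qed.

Lemma form_eval_eq s s' t t' :
  form_of s =2 form_of s' -> form_of t =2 form_of t' -> form_eval s t = form_eval s' t'.
Proof.
have evr u v v' : form_of v =2 form_of v' -> form_eval u v = form_eval u v'.
  by move=> h; apply: eq_bigr => p _; rewrite h.
by move=> hs ht; rewrite (evr s _ _ ht) form_eval_conj (evr _ _ _ hs) -form_eval_conj.
Qed.

Lemma form_eval_pos s : 0 <= form_eval s s /\ (form_eval s s = 0 -> forall x y, form_of s x y = 0).
Proof.
have [n] := ubnP (size s); elim: n s => // n IHn [|[a b] s] /=.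
  by rewrite /form_eval big_nil => _; split=> // _ x y; rewrite /form_of big_nil.
rewrite ltnS => sn.
have [a0|a0] := eqVneq a 0.
  have Es : form_of ((a, b) :: s) =2 form_of s.
    by move=> x y; rewrite form_of_cons /= a0 inner0r mul0r add0r.
  rewrite (form_eval_eq Es Es); case: (IHn s sn) => h0 h1.
  by split=> // h x y; rewrite Es h1.
pose c (p : H1 * H2) := '[a, p.1] / '[a, a].
pose b' := b + \sum_(p <- s) c p *: p.2.
pose s' := [seq (p.1 - c p *: a, p.2) | p <- s].
have Es : form_of ((a, b) :: s) =2 form_of ((a, b') :: s').
  move=> x y; rewrite !form_of_cons /= /b' innerDr mulrDr -addrA; congr (_ + _).
  rewrite inner_sumr mulr_sumr /form_of big_map -big_split /=.
  apply: eq_bigr => p _; rewrite innerBr !innerZr; ring.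
have orth p : p \in s' -> '[a, p.1] = 0.
  move=> /mapP[q _ ->] /=; rewrite innerBr innerZr /c divfK ?subrr //.
  by rewrite inner_eq0.
have aF y : form_of s' a y = 0.
  by rewrite /form_of big_seq big1 // => p /orth ->; rewrite mul0r.
have Eev : form_eval ((a, b') :: s') ((a, b') :: s')
    = '[a, a] * '[b', b'] + form_eval s' s'.
  rewrite /form_eval big_cons /= form_of_cons aF addr0; congr (_ + _).
  rewrite big_seq [RHS]big_seq; apply: eq_bigr => p /orth ap.
  by rewrite form_of_cons /= inner_conj ap conjC0 mul0r add0r.
rewrite (form_eval_eq Es Es) Eev.
have [|h0 h1] := IHn s'; first by rewrite size_map.
have ab0 : 0 <= '[a, a] * '[b', b'] by rewrite mulr_ge0 ?inner_ge0.
split=> [|/eqP]; first by rewrite addr_ge0.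
rewrite paddr_eq0 // => /andP[/eqP ab /eqP /h1 F0] x y.
move/eqP: ab; rewrite mulf_eq0 !inner_eq0 (negPf a0) /= => /eqP b'0.
by rewrite Es form_of_cons F0 b'0 inner0r mulr0 addr0.
Qed.

(* Linear relations among elementary tensors are detected by the forms, so
   that every bilinear map factors through [tensor] below. *)
Lemma form_of_eq0 (V : lmodType C) (beta : H1 -> H2 -> V) s :
    (forall y, linear (beta^~ y)) -> (forall x, linear (beta x)) ->
    (forall x y, form_of s x y = 0) ->
  \sum_(p <- s) beta p.1 p.2 = 0.
Proof.
move=> bl br.
pose Lb y := GRing.isLinear.Build C H1 V *:%R (beta^~ y) (bl y).
pose Lr x := GRing.isLinear.Build C H2 V *:%R (beta x) (br x).
pose bL y : {linear H1 -> V} := HB.pack (beta^~ y) (Lb y).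
pose bR x : {linear H2 -> V} := HB.pack (beta x) (Lr x).
have [n] := ubnP (size s); elim: n s => // n IHn [|[a b] s] /=.
  by rewrite big_nil.
rewrite ltnS => sn F0; rewrite big_cons /=.
have [b0|b0] := eqVneq b 0.
  rewrite b0 -[beta a 0]/(bR a 0) linear0 add0r; apply: IHn => // x y.
  by rewrite -[RHS](F0 x y) form_of_cons /= b0 inner0r mulr0 add0r.
have bb0 : '[b, b] != 0 by rewrite inner_eq0.
pose c (p : H1 * H2) := '[b, p.2] / '[b, b].
have aE : a = - \sum_(p <- s) c p *: p.1.
  apply: inner_inj => x; apply: (mulIf bb0).
  rewrite innerNr mulNr; apply/eqP; rewrite -addr_eq0 -(F0 x b); apply/eqP.
  rewrite form_of_cons /=; congr (_ + _).
  rewrite inner_sumr mulr_suml; apply: eq_bigr => p _.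
  by rewrite innerZr mulrAC /c divfK // mulrC.
pose s' := [seq (p.1, p.2 - c p *: b) | p <- s].
have bE : beta a b + \sum_(p <- s) beta p.1 p.2 = \sum_(p <- s') beta p.1 p.2.
  rewrite /s' big_map {1}aE -[beta _ b]/(bL b _) linearN linear_sum /=.
  rewrite -sumrN -big_split /=; apply: eq_bigr => p _.
  rewrite -[beta (_ *: _) b]/(bL b _) linearZ.
  have -> : beta p.1 (p.2 - c p *: b) = beta p.1 p.2 - c p *: beta p.1 b.
    by rewrite -[LHS]/(bR p.1 _) linearB linearZ.
  by rewrite addrC.
rewrite bE; apply: IHn; first by rewrite size_map.
move=> x y; rewrite -(F0 x y) form_of_cons /= aE innerNr inner_sumr mulNr.
rewrite mulr_suml /form_of big_map -sumrN -big_split /=.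
apply: eq_bigr => p _.
by rewrite innerBr !innerZr; ring.
Qed.

Lemma form_of_eq (V : lmodType C) (beta : H1 -> H2 -> V) s t :
    (forall y, linear (beta^~ y)) -> (forall x, linear (beta x)) ->
    form_of s =2 form_of t ->
  \sum_(p <- s) beta p.1 p.2 = \sum_(p <- t) beta p.1 p.2.
Proof.
move=> bl br st; apply/eqP; rewrite -subr_eq0; apply/eqP.
pose t' := [seq (-1 *: p.1, p.2) | p <- t].
rewrite -[RHS](@form_of_eq0 V beta (s ++ t')) //.
  rewrite big_cat big_map /= -sumrN; congr (_ + _); apply: eq_bigr => p _.
  pose Lb y := GRing.isLinear.Build C H1 V *:%R (beta^~ y) (bl y).
  pose bL y : {linear H1 -> V} := HB.pack (beta^~ y) (Lb y).
  by rewrite -[beta (_ *: _) _]/(bL p.2 _) linearZ /= scaleN1r.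
by move=> x y; rewrite form_of_cat form_of_scale st mulN1r subrr.
Qed.

End TensorForms.

Section Tensor.
Context {C : numClosedFieldType} (H1 H2 : preHilbertType C).

(* The algebraic tensor product, realized as the space of sesquilinear forms
   spanned by the elementary tensors
     a ⊗ b := (x, y) |-> <x, a> <y, b>.
   Since inner products are nondegenerate this has the universal property of
   the tensor product; see [tlift_tens] and [tensor_ext] below. *)
Record tensor := Tensor {
  tensor_form :> H1 -> H2 -> C;
  tensor_spanned : exists s : seq (H1 * H2), tensor_form = form_of s
}.

HB.instance Definition _ := gen_eqMixin tensor.
HB.instance Definition _ := gen_choiceMixin tensor.

Lemma tensor_eq (f g : tensor) : (forall x y, f x y = g x y) -> f = g.
Proof.
case: f g => [f fP] [g gP] /= fg.
have {}fg : f = g by apply/funext => x; apply/funext => y.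
by move: fP; rewrite fg => fP; congr Tensor; apply: Prop_irrelevance.
Qed.

Definition tensor_of s : tensor := locked (Tensor (ex_intro _ s erefl)).

Lemma tensor_ofE s x y : tensor_of s x y = form_of s x y.
Proof. by rewrite /tensor_of -lock. Qed.

Definition tens (x : H1) (y : H2) : tensor := tensor_of [:: (x, y)].

Definition trepr (f : tensor) : seq (H1 * H2) :=
  sval (cid (tensor_spanned f)).

Lemma treprE (f : tensor) x y : form_of (trepr f) x y = f x y.
Proof. by rewrite /trepr; case: cid => s /= ->. Qed.

Lemma tensE a b x y : tens a b x y = '[x, a] * '[y, b].
Proof. by rewrite tensor_ofE /form_of big_seq1. Qed.

Definition tscale (a : C) (f : tensor) : tensor :=
  tensor_of [seq (a *: p.1, p.2) | p <- trepr f].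
Definition tadd (f g : tensor) : tensor := tensor_of (trepr f ++ trepr g).
Definition tzero : tensor := tensor_of [::].
Definition topp (f : tensor) : tensor := tscale (-1) f.

Lemma tscaleE a f x y : tscale a f x y = a * f x y.
Proof. by rewrite tensor_ofE form_of_scale treprE. Qed.
Lemma taddE f g x y : tadd f g x y = f x y + g x y.
Proof. by rewrite tensor_ofE form_of_cat !treprE. Qed.
Lemma tzeroE x y : tzero x y = 0.
Proof. by rewrite tensor_ofE /form_of big_nil. Qed.
Lemma toppE f x y : topp f x y = - f x y.
Proof. by rewrite tscaleE mulN1r. Qed.

Lemma taddA : associative tadd.
Proof. by move=> f g h; apply: tensor_eq => x y; rewrite !taddE addrA. Qed.
Lemma taddC : commutative tadd.
Proof. by move=> f g; apply: tensor_eq => x y; rewrite !taddE addrC. Qed.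
Lemma tadd0 : left_id tzero tadd.
Proof. by move=> f; apply: tensor_eq => x y; rewrite taddE tzeroE add0r. Qed.
Lemma taddN : left_inverse tzero topp tadd.
Proof.
by move=> f; apply: tensor_eq => x y; rewrite taddE toppE tzeroE addNr.
Qed.

HB.instance Definition _ := GRing.isZmodule.Build tensor taddA taddC tadd0 taddN.

Lemma tscaleA a b f : tscale a (tscale b f) = tscale (a * b) f.
Proof. by apply: tensor_eq => x y; rewrite !tscaleE mulrA. Qed.
Lemma tscale1 : left_id 1 tscale.
Proof. by move=> f; apply: tensor_eq => x y; rewrite tscaleE mul1r. Qed.
Lemma tscaleDr : right_distributive tscale +%R.
Proof.
by move=> a f g; apply: tensor_eq => x y; rewrite !(tscaleE, taddE) mulrDr.
Qed.
Lemma tscaleDl f : {morph tscale^~ f : a b / a + b}.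
Proof.
by move=> a b; apply: tensor_eq => x y; rewrite !(tscaleE, taddE) mulrDl.
Qed.

HB.instance Definition _ := GRing.Zmodule_isLmodule.Build C tensor
  tscaleA tscale1 tscaleDr tscaleDl.

Lemma tensorDE (f g : tensor) x y : (f + g) x y = f x y + g x y.
Proof. exact: taddE. Qed.
Lemma tensorZE a (f : tensor) x y : (a *: f) x y = a * f x y.
Proof. exact: tscaleE. Qed.
Lemma tensor0E x y : (0 : tensor) x y = 0.
Proof. exact: tzeroE. Qed.
Lemma tensor_sumE I (r : seq I) (P : pred I) (F : I -> tensor) x y :
  (\sum_(i <- r | P i) F i) x y = \sum_(i <- r | P i) F i x y.
Proof.
exact: (big_morph (fun f : tensor => f x y) (fun f g => tensorDE f g x y)
  (tensor0E x y)).
Qed.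

Lemma trepr_sum (f : tensor) : f = \sum_(p <- trepr f) tens p.1 p.2.
Proof.
apply: tensor_eq => x y; rewrite tensor_sumE -treprE /form_of.
by apply: eq_bigr => p _; rewrite tensE.
Qed.

Definition tinner (f g : tensor) : C := \sum_(p <- trepr f) g p.1 p.2.
Definition tOmega : tensor := tens Omega Omega.

Lemma tinner_form_eval f g : tinner f g = form_eval (trepr f) (trepr g).
Proof. by apply: eq_bigr => p _; rewrite treprE. Qed.

Lemma tinner_tens a b (g : tensor) : tinner (tens a b) g = g a b.
Proof.
rewrite tinner_form_eval (@form_eval_eq _ _ _ _ [:: (a, b)] _ (trepr g)) //.
  by rewrite /form_eval big_seq1 treprE.
by move=> x y; rewrite treprE tensor_ofE.
Qed.

Lemma tinner_scalar f : scalar (tinner f).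
Proof.
move=> a g h; rewrite /tinner mulr_sumr -big_split /=.
by apply: eq_bigr => p _; rewrite tensorDE tensorZE.
Qed.
Lemma tinner_conj f g : tinner g f = (tinner f g)^*.
Proof. by rewrite !tinner_form_eval form_eval_conj. Qed.
Lemma tinner_gt0 f : f != 0 -> 0 < tinner f f.
Proof.
have [ge0 eq0] := form_eval_pos (trepr f).
rewrite tinner_form_eval lt0r ge0 andbT; apply: contraNneq => /eq0 f0.
by apply/eqP/tensor_eq => x y; rewrite -treprE f0 tensor0E.
Qed.
Lemma tinner_Omega : tinner tOmega tOmega = 1.
Proof. by rewrite tinner_tens tensE !inner_Omega mulr1. Qed.

HB.instance Definition _ := isPreHilbert.Build C tensor
  tinner_scalar tinner_conj tinner_gt0 tinner_Omega.

Lemma inner_tens a b (g : tensor) : '[tens a b, g] = g a b.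
Proof. exact: tinner_tens. Qed.

Lemma tens_linearl y : linear (tens^~ y).
Proof.
move=> a x x'; apply: tensor_eq => u v.
by rewrite tensorDE tensorZE !tensE innerDr innerZr mulrDl mulrA.
Qed.
Lemma tens_linearr x : linear (tens x).
Proof.
move=> a y y'; apply: tensor_eq => u v.
by rewrite tensorDE tensorZE !tensE innerDr innerZr mulrDr mulrCA.
Qed.

Lemma tensor_ext (V : lmodType C) (f g : {linear tensor -> V}) :
  (forall x y, f (tens x y) = g (tens x y)) -> f =1 g.
Proof.
by move=> fg u; rewrite (trepr_sum u) !linear_sum; apply: eq_bigr.
Qed.

End Tensor.

Notation "H1 ⊗ H2" := (tensor H1 H2) : type_scope.
Notation "x ⊗ y" := (tens x y) : ring_scope.

Section TensorLift.
Context {C : numClosedFieldType} {H1 H2 : preHilbertType C} {V : lmodType C}.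
Variable beta : H1 -> H2 -> V.

(* The linear map on the tensor product induced by a bilinear map. *)
Definition tlift (f : tensor H1 H2) : V := \sum_(p <- trepr f) beta p.1 p.2.

Hypothesis betal : forall y, linear (beta^~ y).
Hypothesis betar : forall x, linear (beta x).

Lemma tlift_of (f : tensor H1 H2) s : (forall x y, form_of s x y = f x y) ->
  tlift f = \sum_(p <- s) beta p.1 p.2.
Proof. by move=> h; apply: form_of_eq => // x y; rewrite treprE h. Qed.

Lemma tlift_tens x y : tlift (x ⊗ y) = beta x y.
Proof. by rewrite (@tlift_of _ [:: (x, y)]) ?big_seq1 // => u v; rewrite tensor_ofE. Qed.

Lemma tlift_linear : linear tlift.
Proof.
move=> a f g.
rewrite (@tlift_of _ ([seq (a *: p.1, p.2) | p <- trepr f] ++ trepr g)).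
  rewrite big_cat big_map /= scaler_sumr; congr (_ + _).
  apply: eq_bigr => p _; have /(_ a p.1 0) := betal p.2.
  pose Lb := GRing.isLinear.Build C H1 V *:%R (beta^~ p.2) (betal p.2).
  pose bL : {linear H1 -> V} := HB.pack (beta^~ p.2) Lb.
  by rewrite -[beta 0 _]/(bL 0) linear0 !addr0.
by move=> x y; rewrite form_of_cat form_of_scale !treprE tensorDE tensorZE.
Qed.

End TensorLift.

Section TensorMaps.
Context {C : numClosedFieldType}.
Implicit Types H G : preHilbertType C.

Section Map.
Context {H1 H2 G1 G2 : preHilbertType C}.
Variables (A : {linear H1 -> G1}) (B : {linear H2 -> G2}).

Definition tmap : tensor H1 H2 -> tensor G1 G2 :=
  tlift (fun x y => A x ⊗ B y).

Lemma tmap_betal y : linear (fun x => A x ⊗ B y).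
Proof. by move=> a x x'; rewrite linearP tens_linearl. Qed.
Lemma tmap_betar x : linear (fun y => A x ⊗ B y).
Proof. by move=> a y y'; rewrite linearP tens_linearr. Qed.

HB.instance Definition _ :=
  GRing.isLinear.Build C (tensor H1 H2) (tensor G1 G2) *:%R tmap
    (tlift_linear tmap_betal tmap_betar).

Lemma tmap_tens x y : tmap (x ⊗ y) = A x ⊗ B y.
Proof. exact: tlift_tens tmap_betal tmap_betar x y. Qed.

End Map.

Section Op.
Context {H1 H2 : preHilbertType C}.
Variables (S : adjop H1) (T : adjop H2).

Lemma tensop_adjointable : exists T' : tensor H1 H2 -> tensor H1 H2,
  forall x y, '[T' x, y] = '[x, tmap S T y].
Proof.
exists (tmap S^† T^†) => f g; rewrite (trepr_sum f) (trepr_sum g).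
rewrite ![tmap _ _ _]linear_sum !inner_suml; apply: eq_bigr => p _.
rewrite !inner_sumr; apply: eq_bigr => q _.
by rewrite /= !tmap_tens !inner_tens !tensE !adjP.
Qed.

Definition tensop : adjop (tensor H1 H2) :=
  AdjOp (linearP (tmap S T)) tensop_adjointable.

Lemma tensop_tens x y : tensop (x ⊗ y) = S x ⊗ T y.
Proof. exact: tmap_tens. Qed.

End Op.

Section Assoc.
Variables H1 H2 H3 : preHilbertType C.

Definition tassoc3 (z : H3) : tensor H1 H2 -> tensor H1 (tensor H2 H3) :=
  tlift (fun x y => x ⊗ (y ⊗ z)).

(* The identification of (H1 ⊗ H2) ⊗ H3 with H1 ⊗ (H2 ⊗ H3). *)
Definition tassoc :
    tensor (tensor H1 H2) H3 -> tensor H1 (tensor H2 H3) :=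
  tlift (fun f z => tassoc3 z f).

Lemma tassoc3_betal z y : 
  linear (fun x : H1 => (x ⊗ ((y : H2) ⊗ (z : H3)) : tensor H1 (tensor H2 H3))).
Proof. exact: tens_linearl. Qed.
Lemma tassoc3_betar z x : 
  linear (fun y : H2 => ((x : H1) ⊗ (y ⊗ (z : H3)) : tensor H1 (tensor H2 H3))).
Proof. by move=> a y y'; rewrite tens_linearl tens_linearr. Qed.

Lemma tassoc3_tens x y z : tassoc3 z (x ⊗ y) = x ⊗ (y ⊗ z).
Proof. exact: tlift_tens (tassoc3_betal z) (tassoc3_betar z) x y. Qed.

Lemma tassoc3_linear z : linear (tassoc3 z).
Proof. exact: tlift_linear (tassoc3_betal z) (tassoc3_betar z). Qed.

HB.instance Definition _ z := GRing.isLinear.Build C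
  (tensor H1 H2) (tensor H1 (tensor H2 H3)) *:%R (tassoc3 z) (tassoc3_linear z).

Lemma tassoc_betar f : linear (tassoc3^~ f).
Proof.
move=> a z z'; rewrite (trepr_sum f) ![tassoc3 _ _]linear_sum scaler_sumr -big_split /=.
by apply: eq_bigr => p _; rewrite !tassoc3_tens !tens_linearr.
Qed.

Lemma tassoc_linear : linear tassoc.
Proof. exact: tlift_linear tassoc3_linear tassoc_betar. Qed.

HB.instance Definition _ := GRing.isLinear.Build C
  (tensor (tensor H1 H2) H3) (tensor H1 (tensor H2 H3)) *:%R
  tassoc tassoc_linear.

Lemma tassoc_tens x y z : tassoc ((x ⊗ y) ⊗ z) = x ⊗ (y ⊗ z).
Proof.
rewrite /tassoc (tlift_tens tassoc3_linear tassoc_betar).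
exact: tassoc3_tens.
Qed.

Lemma tens_suml (G1 G2 : preHilbertType C) I (r : seq I) (F : I -> G1)
    (y : G2) : (\sum_(i <- r) F i) ⊗ y = \sum_(i <- r) F i ⊗ y.
Proof.
apply: tensor_eq => u v; rewrite tensE tensor_sumE inner_sumr mulr_suml.
by apply: eq_bigr => i _; rewrite tensE.
Qed.
Lemma tens_sumr (G1 G2 : preHilbertType C) I (r : seq I) (F : I -> G2)
    (x : G1) : x ⊗ (\sum_(i <- r) F i) = \sum_(i <- r) x ⊗ F i.
Proof.
apply: tensor_eq => u v; rewrite tensE tensor_sumE inner_sumr mulr_sumr.
by apply: eq_bigr => i _; rewrite tensE.
Qed.

Lemma tensor3_ind (P : tensor (tensor H1 H2) H3 -> Prop) :
    P 0 -> (forall f g, P f -> P g -> P (f + g)) ->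
    (forall x y z, P ((x ⊗ y) ⊗ z)) -> forall f, P f.
Proof.
move=> P0 PD Pt f; rewrite (trepr_sum f); apply: big_ind => // -[g z] _ /=.
rewrite (trepr_sum g) tens_suml; exact: big_ind.
Qed.

Lemma tassoc_isometry f g : '[tassoc f, tassoc g] = '[f, g].
Proof.
elim/tensor3_ind: f => [|f f' hf hf'|x y z].
- by rewrite linear0 !inner0l.
- by rewrite linearD !innerDl hf hf'.
elim/tensor3_ind: g => [|f f' hf hf'|x' y' z'].
- by rewrite [tassoc 0]linear0 !inner0r.
- by rewrite [tassoc (_ + _)]linearD !innerDr hf hf'.
by rewrite !tassoc_tens !inner_tens !tensE !inner_tens !tensE mulrA.
Qed.

Lemma tassoc_inj : injective tassoc.
Proof.
move=> f g fg; apply/eqP; rewrite -subr_eq0 -inner_eq0 -tassoc_isometry.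
by rewrite [tassoc _](linearB (tassoc : {linear _ -> _})) /= fg subrr inner0r.
Qed.

Lemma tassoc_surj g : exists f, tassoc f = g.
Proof.
rewrite (trepr_sum g).
apply: (big_ind (fun h => exists f, tassoc f = h)) => [|h h' [f <-] [f' <-]|].
- by exists 0; rewrite linear0.
- by exists (f + f'); rewrite linearD.
move=> [x w] _ /=; rewrite (trepr_sum w) tens_sumr.
apply: (big_ind (fun h => exists f, tassoc f = h)) => [|h h' [f <-] [f' <-]|].
- by exists 0; rewrite linear0.
- by exists (f + f'); rewrite linearD.
by move=> [y z] _ /=; exists ((x ⊗ y) ⊗ z); rewrite tassoc_tens.
Qed.

Lemma tassoc_Omega : tassoc Omega = Omega.
Proof. exact: tassoc_tens. Qed.

End Assoc.
End TensorMaps.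

Section UniversalLifts.
Variable C : numClosedFieldType.
Implicit Types H G : preHilbertType C.

Definition left_family :=
  forall H1 H2 : preHilbertType C, adjop H1 -> adjop (tensor H1 H2).
Definition right_family :=
  forall H1 H2 : preHilbertType C, adjop H2 -> adjop (tensor H1 H2).

Record left_universal_lift (lam : left_family) : Prop := {
  left_star_hom : forall H1 H2, star_hom (lam H1 H2);
  left_assoc : forall H1 H2 H3 (T : adjop H1) v,
    tassoc (lam (tensor H1 H2) H3 (lam H1 H2 T) v)
      = lam H1 (tensor H2 H3) T (tassoc v);
  left_universality : forall H1 H2 G1 G2 (T : adjop H1) (S : adjop G1)
      (W1 : {linear H1 -> G1}) (W2 : {linear H2 -> G2}),
    is_arrow W1 -> is_arrow W2 ->
    (forall x, W1 (T x) = S (W1 x)) ->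
    (forall x, W1 (T^† x) = S^† (W1 x)) ->
    forall v, tmap W1 W2 (lam H1 H2 T v) = lam G1 G2 S (tmap W1 W2 v);
  left_restriction : forall H1 H2 (T : adjop H1) x,
    lam H1 H2 T (x ⊗ Omega) = T x ⊗ Omega
}.

Record right_universal_lift (rho : right_family) : Prop := {
  right_star_hom : forall H1 H2, star_hom (rho H1 H2);
  right_assoc : forall H1 H2 H3 (T : adjop H3) v,
    tassoc (rho (tensor H1 H2) H3 T v)
      = rho H1 (tensor H2 H3) (rho H2 H3 T) (tassoc v);
  right_universality : forall H1 H2 G1 G2 (T : adjop H2) (S : adjop G2)
      (W1 : {linear H1 -> G1}) (W2 : {linear H2 -> G2}),
    is_arrow W1 -> is_arrow W2 ->
    (forall x, W2 (T x) = S (W2 x)) ->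
    (forall x, W2 (T^† x) = S^† (W2 x)) ->
    forall v, tmap W1 W2 (rho H1 H2 T v) = rho G1 G2 S (tmap W1 W2 v);
  right_restriction : forall H1 H2 (T : adjop H2) y,
    rho H1 H2 T (Omega ⊗ y) = Omega ⊗ T y
}.

Record universal_lift (lam : left_family) (rho : right_family) : Prop := {
  universal_lift_left : left_universal_lift lam;
  universal_lift_right : right_universal_lift rho;
  middle_assoc : forall H1 H2 H3 (T : adjop H2) v,
    tassoc (lam (tensor H1 H2) H3 (rho H1 H2 T) v)
      = rho H1 (tensor H2 H3) (lam H2 H3 T) (tassoc v)
}.

Definition lambda_lift (g : C) : left_family := fun H1 H2 X =>
  tensop X P_Omega + tensop (twist g X) P_perp.

Definition rho_lift (g : C) : right_family := fun H1 H2 Y =>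
  tensop P_Omega Y + tensop P_perp (twist g Y).

Definition circle0 : set C := [set z | `|z| = 1 \/ z = 0].

Definition J_tensor : set (C * C) :=
  [set p | [/\ circle0 p.1, circle0 p.2 & [\/ p.1 = p.2, p.1 = 0 | p.2 = 0]]].

End UniversalLifts.

Arguments lambda_lift {C} g H1 H2 X.
Arguments rho_lift {C} g H1 H2 Y.

(* Main.v *)
(* A family of vectors or operators that commutes with all arrows is, by a
   reflection argument, a P_Omega + b P_perp with universal scalars a and b.
   Contracting lambda(T) with vectors of the first factor yields such a family
   in the second factor, so restriction gives
   lambda(T) = T ⊗ P_Omega + k(T) ⊗ P_perp, where k is a natural family of
   *-homomorphisms of the algebra of H into itself.  Then k(P_Omega) equals
   a P_Omega + b P_perp with a, b in {0, 1}, and dimension three excludes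
   b = 1.  If a = 0, then k kills every rank-one operator, hence the identity,
   and k = 0.  If a = 1, then u |-> k(|u><Omega|) Omega is natural, hence equals
   P_Omega + g P_perp; it is isometric, so |g| = 1, and it intertwines T with
   k(T), whence k(T) is the twist of T by g.  The right lifts follow by
   exchanging the two factors, and middle associativity for (g, d) amounts to
   |d| T_g = |g| T_d for all T. *)
From HB Require Import structures.
Require Import Defs.
From mathcomp Require Import all_boot all_order all_algebra.
From mathcomp Require Import boolp complex classical_sets reals.

Set Implicit Arguments.
Unset Strict Implicit.
Unset Printing Implicit Defensive.

Import Order.TTheory GRing.Theory Num.Theory.

Local Open Scope ring_scope.

(** * Projections, rank-one operators, and the twist as a conjugation *)

Section Projections.
Context {C : numClosedFieldType} {H : preHilbertType C}.
Implicit Types (x u v : H) (S T : adjop H) (g : C).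

Lemma P_OmegaE x : P_Omega x = '[Omega, x] *: Omega.
Proof. by []. Qed.

Lemma P_perpE x : P_perp x = x - '[Omega, x] *: Omega.
Proof. by []. Qed.

Lemma P_Omega_Omega : P_Omega Omega = Omega :> H.
Proof. by rewrite P_OmegaE inner_Omega scale1r. Qed.

Lemma P_perp_Omega : P_perp Omega = 0 :> H.
Proof. by rewrite P_perpE inner_Omega scale1r subrr. Qed.

Lemma P_Omega_perp x : '[Omega, x] = 0 -> P_Omega x = 0.
Proof. by rewrite P_OmegaE => ->; rewrite scale0r. Qed.

Lemma P_perp_id x : '[Omega, x] = 0 -> P_perp x = x.
Proof. by rewrite P_perpE => ->; rewrite scale0r subr0. Qed.

Lemma inner_Omega_P_perp x : '[Omega, P_perp x] = 0.
Proof. by rewrite P_perpE innerBr innerZr inner_Omega mulr1 subrr. Qed.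

Lemma adj_ketbra u v : (ketbra u v)^† = ketbra v u.
Proof.
apply: adj_unique => x y /=.
by rewrite innerZl innerZr -inner_conj mulrC.
Qed.

Lemma mul_ketbra T u v : T * ketbra u v = ketbra (T u) v.
Proof. by apply: adjop_eq => x; rewrite adjopME /= linearZ. Qed.

Lemma ketbra_mul u v x w : ketbra u v * ketbra x w = '[v, x] *: ketbra u w.
Proof.
by apply: adjop_eq => y; rewrite adjopME adjopZE /= innerZr !scalerA mulrC.
Qed.

Lemma ketbra_linearl v : linear (fun u : H => ketbra u v).
Proof.
move=> a x y; apply: adjop_eq => w.
by rewrite adjopDE adjopZE /= scalerDr !scalerA mulrC.
Qed.

Lemma adj_P_Omega : (P_Omega : adjop H)^† = P_Omega.
Proof. exact: adj_ketbra. Qed.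

Lemma P_OmegaK : P_Omega * P_Omega = P_Omega :> adjop H.
Proof. by rewrite ketbra_mul inner_Omega scale1r. Qed.
Lemma P_Omega_P_perp : P_Omega * P_perp = 0 :> adjop H.
Proof. by rewrite mulrBr mulr1 P_OmegaK subrr. Qed.
Lemma P_perp_P_Omega : P_perp * P_Omega = 0 :> adjop H.
Proof. by rewrite mulrBl mul1r P_OmegaK subrr. Qed.
Lemma P_perpK : P_perp * P_perp = P_perp :> adjop H.
Proof. by rewrite {1}/P_perp mulrBl mul1r P_Omega_P_perp subr0. Qed.
Definition PE := (P_OmegaK, P_Omega_P_perp, P_perp_P_Omega, P_perpK).

Lemma P_OmegaD : P_Omega + P_perp = 1 :> adjop H.
Proof. by rewrite addrC subrK. Qed.

Lemma P_OmegaDE x : x = P_Omega x + P_perp x.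
Proof. by rewrite -adjopDE P_OmegaD. Qed.

Lemma adjM S T : (S * T)^† = T^† * S^†.
Proof. by apply: adj_unique => x y; rewrite !adjopME !adjP. Qed.
Lemma adjD S T : (S + T)^† = S^† + T^†.
Proof. by apply: adj_unique => x y; rewrite !adjopDE innerDl innerDr !adjP. Qed.
Lemma adjZ a T : (a *: T)^† = a^* *: T^†.
Proof.
by apply: adj_unique => x y; rewrite !adjopZE innerZl innerZr conjCK adjP.
Qed.
Lemma adj_op1 : (1 : adjop H)^† = 1.
Proof. exact: adj_unique. Qed.
Lemma adj0 : (0 : adjop H)^† = 0.
Proof. by apply: adj_unique => x y; rewrite inner0l inner0r. Qed.

(* Conjugation by this operator is [twist g] when [g] has modulus one. *)
Definition phase g : adjop H := P_Omega + g *: P_perp.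

Lemma adj_phase g : (phase g)^† = phase g^*.
Proof. by rewrite adjD adjZ adj_P_Omega P_perp_sa. Qed.

Lemma phase_conjK g : `|g| = 1 -> phase g^* * phase g = 1.
Proof.
move=> g1; rewrite mulrDl !mulrDr -!scalerAl -!scalerAr !PE !scaler0 addr0.
by rewrite add0r scalerA mulrC -normCK g1 expr1n scale1r P_OmegaD.
Qed.

Lemma phaseK g : `|g| = 1 -> phase g * phase g^* = 1.
Proof. by move=> g1; rewrite -{1}(conjCK g) phase_conjK // norm_conjC. Qed.

Lemma twist0 T : twist 0 T = 0.
Proof.
apply: adjop_eq => x; rewrite /twist /block_op normr0 mul0r !scale0r.
by rewrite !adjopDE /= inner0l scale0r scaler0 !addr0.
Qed.

(** The unitary [phase g] fixes [Omega] and multiplies its orthogonal complement by [g]. Conjugation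
    therefore fixes the scalar block, multiplies the column by [g] and the row by [g^*], and
    multiplies the remaining block by [g * g^* = 1]. *)
Lemma twist_phase g T : `|g| = 1 -> twist g T = phase g * T * (phase g)^†.
Proof.
move=> g1; rewrite /twist g1 mul1r scale1r adj_phase [in RHS](block_opE T).
rewrite /block_op /block_t /block_t' /block_hat.
set u := T _; set v := T^† _; set t := block_tau T.
have Kl u' v' : phase g * ketbra u' v' = ketbra (phase g u') v'.
  exact: mul_ketbra.
have Kr u' v' : ketbra u' v' * phase g^* = ketbra u' (phase g v').
  by apply: (can_inj (@adjK _ _)); rewrite adjM !adj_ketbra -adj_phase adjK Kl.
have rO : phase g Omega = Omega.
  by rewrite /phase !adjopDE adjopZE P_Omega_Omega P_perp_Omega scaler0 addr0.
have rK : phase g * (P_perp * T * P_perp) * phase g^* = P_perp * T * P_perp.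
  have Pl : phase g * P_perp = g *: P_perp.
    by rewrite mulrDl -scalerAl !PE add0r.
  have Pr : P_perp * phase g^* = g^* *: P_perp.
    by rewrite mulrDr -scalerAr !PE add0r.
  rewrite !mulrA Pl -!mulrA Pr -scalerAl -!scalerAr.
  by rewrite scalerA -normCK g1 expr1n scale1r.
have rP x : phase g (P_perp x) = g *: P_perp x.
  by rewrite adjopDE adjopZE -!adjopME !PE adjop0E add0r.
move: (phase g) (phase g^*) (_ * P_perp) Kl Kr rO rP rK.
move=> r r' K Kl Kr rO rP rK.
by rewrite !mulrDr !mulrDl -scalerAr -scalerAl !Kl !Kr rO !rP rK.
Qed.

End Projections.

(** * The twist as a *-homomorphism *)

Section TwistMorphism.
Context {C : numClosedFieldType} {H : preHilbertType C}.
Variable g : C.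
Hypothesis gP : circle0 g.

Lemma twist_linear : linear (@twist C H g).
Proof.
move=> a S T; case: gP => [g1|->]; last by rewrite !twist0 scaler0 addr0.
by rewrite !twist_phase // mulrDr mulrDl -scalerAr -scalerAl.
Qed.

(** On the circle the inner factors [phase g^* * phase g] cancel; at [g = 0] both sides vanish. *)
Lemma twistM (S T : adjop H) : twist g (S * T) = twist g S * twist g T.
Proof.
case: gP => [g1|->]; last by rewrite !twist0 mul0r.
rewrite !twist_phase // adj_phase -!mulrA; congr (_ * (_ * _)).
by rewrite !mulrA phase_conjK ?mul1r.
Qed.

Lemma twist_adj (T : adjop H) : twist g T^† = (twist g T)^†.
Proof.
case: gP => [g1|->]; last by rewrite !twist0 adj0.
by rewrite !twist_phase // !adjM adjK mulrA.
Qed.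

End TwistMorphism.

(** * Operators that commute with arrows *)

Section Arrows.
Context {C : numClosedFieldType} {H G : preHilbertType C} (W : {linear H -> G}).
Hypothesis arrW : is_arrow W.

Lemma arrow_P_Omega x : W (P_Omega x) = P_Omega (W x).
Proof.
case: arrW => iW WO.
by rewrite !P_OmegaE linearZ /= WO -{2}WO iW.
Qed.

Lemma arrow_P_perp x : W (P_perp x) = P_perp (W x).
Proof. by rewrite !adjopBE linearB /= arrow_P_Omega. Qed.

Lemma arrow_phase g x : W (phase g x) = phase g (W x).
Proof.
rewrite !adjopDE !adjopZE -arrow_P_Omega -arrow_P_perp.
by rewrite linearD linearZ_LR.
Qed.

Lemma arrow_twist g (T : adjop H) (S : adjop G) : circle0 g ->
  (forall x, W (T x) = S (W x)) -> forall x, W (twist g T x) = twist g S (W x).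
Proof.
move=> [g1|->] WT x; last by rewrite !twist0 linear0.
by rewrite !twist_phase // !adj_phase !adjopME arrow_phase WT arrow_phase.
Qed.

Lemma arrow_ketbra u v x : W (ketbra u v x) = ketbra (W u) (W v) (W x).
Proof. by case: arrW => iW _; rewrite /= linearZ /= iW. Qed.

End Arrows.

(** * Algebra of operators on tensor products *)

Section TensorOperators.
Context {C : numClosedFieldType} {H1 H2 : preHilbertType C}.
Implicit Types (S : adjop H1) (T : adjop H2).

Lemma tensDl (x x' : H1) (y : H2) : (x + x') ⊗ y = x ⊗ y + x' ⊗ y.
Proof. by have := tens_linearl y 1 x x'; rewrite !scale1r. Qed.
Lemma tensDr (x : H1) (y y' : H2) : x ⊗ (y + y') = x ⊗ y + x ⊗ y'.
Proof. by have := tens_linearr x 1 y y'; rewrite !scale1r. Qed.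
Lemma tens0l (y : H2) : (0 : H1) ⊗ y = 0.
Proof. by apply: tensor_eq => u v; rewrite tensE inner0r mul0r tensor0E. Qed.
Lemma tens0r (x : H1) : x ⊗ (0 : H2) = 0.
Proof. by apply: tensor_eq => u v; rewrite tensE inner0r mulr0 tensor0E. Qed.
Lemma tensZl a (x : H1) (y : H2) : (a *: x) ⊗ y = a *: (x ⊗ y).
Proof. by rewrite -[a *: x]addr0 tens_linearl tens0l addr0. Qed.
Lemma tensZr a (x : H1) (y : H2) : x ⊗ (a *: y) = a *: (x ⊗ y).
Proof. by rewrite -[a *: y]addr0 tens_linearr tens0r addr0. Qed.

Lemma inner_tensE (x x' : H1) (y y' : H2) :
  '[x ⊗ y, x' ⊗ y'] = '[x, x'] * '[y, y'].
Proof. by rewrite inner_tens tensE. Qed.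

Lemma tens_injl (y : H2) : '[y, y] = 1 -> injective (fun x : H1 => x ⊗ y).
Proof.
move=> y1 x x' /= xy; apply: inner_inj => z.
by have := congr1 (inner (z ⊗ y)) xy; rewrite !inner_tensE y1 !mulr1.
Qed.

Lemma adjop_tens_eq (S T : adjop (H1 ⊗ H2)%type) :
  (forall x y, S (x ⊗ y) = T (x ⊗ y)) -> S = T.
Proof. by move=> ST; apply: adjop_eq; apply: tensor_ext. Qed.

Lemma tensopM S S' T T' : tensop S T * tensop S' T' = tensop (S * S') (T * T').
Proof. by apply: adjop_tens_eq => x y; rewrite adjopME !tensop_tens. Qed.
Lemma tensopDl S S' T : tensop (S + S') T = tensop S T + tensop S' T.
Proof.
by apply: adjop_tens_eq => x y; rewrite adjopDE !tensop_tens adjopDE tensDl.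
Qed.
Lemma tensopDr S T T' : tensop S (T + T') = tensop S T + tensop S T'.
Proof.
by apply: adjop_tens_eq => x y; rewrite adjopDE !tensop_tens adjopDE tensDr.
Qed.
Lemma tensopZl a S T : tensop (a *: S) T = a *: tensop S T.
Proof.
by apply: adjop_tens_eq => x y; rewrite adjopZE !tensop_tens adjopZE tensZl.
Qed.
Lemma tensopZr a S T : tensop S (a *: T) = a *: tensop S T.
Proof.
by apply: adjop_tens_eq => x y; rewrite adjopZE !tensop_tens adjopZE tensZr.
Qed.
Lemma tensop0l T : tensop (0 : adjop H1) T = 0.
Proof. by rewrite -(scale0r (0 : adjop H1)) tensopZl scale0r. Qed.
Lemma tensop0r S : tensop S (0 : adjop H2) = 0.
Proof. by rewrite -(scale0r (0 : adjop H2)) tensopZr scale0r. Qed.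
Lemma tensop11 : tensop (1 : adjop H1) (1 : adjop H2) = 1.
Proof. by apply: adjop_tens_eq => x y; rewrite tensop_tens. Qed.

Lemma adj_tensop S T : (tensop S T)^† = tensop S^† T^†.
Proof.
apply: adj_unique => f g; rewrite (trepr_sum f) (trepr_sum g).
rewrite ![tensop _ _ _]linear_sum !inner_suml; apply: eq_bigr => p _.
rewrite !inner_sumr; apply: eq_bigr => q _.
by rewrite /= !tmap_tens !inner_tensE !adjP.
Qed.

Lemma P_Omega_tens : P_Omega = tensop P_Omega P_Omega :> adjop (H1 ⊗ H2)%type.
Proof.
apply: adjop_tens_eq => x y; rewrite tensop_tens !P_OmegaE inner_tensE.
by rewrite tensZl tensZr scalerA.
Qed.

(** This splitting is diagonal in the second factor, which is the shape of a left lift;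
    [P_perp_tensr] is its mirror image for right lifts. *)
Lemma P_perp_tensl :
  P_perp = tensop P_perp P_Omega + tensop 1 P_perp :> adjop (H1 ⊗ H2)%type.
Proof.
rewrite /P_perp P_Omega_tens -tensop11.
apply: (addIr (tensop P_Omega P_Omega)).
by rewrite subrK addrAC -tensopDl subrK -tensopDr addrC subrK.
Qed.

Lemma P_perp_tensr :
  P_perp = tensop P_Omega P_perp + tensop P_perp 1 :> adjop (H1 ⊗ H2)%type.
Proof.
rewrite /P_perp P_Omega_tens -tensop11.
apply: (addIr (tensop P_Omega P_Omega)).
by rewrite subrK addrAC -tensopDr subrK -tensopDl addrC subrK.
Qed.

Lemma tens_diagM_l S S' U U' :
  (tensop S (P_Omega : adjop H2) + tensop S' P_perp)
    * (tensop U P_Omega + tensop U' P_perp)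
  = tensop (S * U) P_Omega + tensop (S' * U') P_perp.
Proof.
rewrite mulrDl (mulrDr (tensop S _)) (mulrDr (tensop S' _)) !tensopM !PE.
by rewrite !tensop0r addr0 add0r.
Qed.

Lemma tens_diagM_r T T' U U' :
  (tensop (P_Omega : adjop H1) T + tensop P_perp T')
    * (tensop P_Omega U + tensop P_perp U')
  = tensop P_Omega (T * U) + tensop P_perp (T' * U').
Proof.
rewrite mulrDl (mulrDr (tensop _ T)) (mulrDr (tensop _ T')) !tensopM !PE.
by rewrite !tensop0l addr0 add0r.
Qed.

(** On the tensor product [phase d] acts as [phase d] over [P_Omega] and as the scalar [d] over
    [P_perp]. Conjugation thus twists [S] and leaves [S'] alone; the factor [|d|] also covers
    [d = 0]. *)
Lemma twist_tensl d S S' : circle0 d ->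
  twist d (tensop S (P_Omega : adjop H2) + tensop S' P_perp)
    = tensop (twist d S) P_Omega + tensop (`|d| *: S') P_perp.
Proof.
move=> [d1|->]; last by rewrite !twist0 normr0 scale0r !tensop0l addr0.
have rE a : phase a = tensop (phase a) P_Omega + tensop (a *: 1) P_perp
    :> adjop (H1 ⊗ H2)%type.
  rewrite {1}/phase P_perp_tensl P_Omega_tens scalerDr addrA -!tensopZl.
  by rewrite -tensopDl.
rewrite !twist_phase // !adj_phase !rE !tens_diagM_l.
rewrite -scalerAr mulr1 -scalerAl mul1r.
by rewrite scalerA -normCKC d1 expr1n.
Qed.

Lemma twist_tensr d T T' : circle0 d ->
  twist d (tensop (P_Omega : adjop H1) T + tensop P_perp T')
    = tensop P_Omega (twist d T) + tensop P_perp (`|d| *: T').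
Proof.
move=> [d1|->]; last by rewrite !twist0 normr0 scale0r !tensop0r addr0.
have rE a : phase a = tensop P_Omega (phase a) + tensop P_perp (a *: 1)
    :> adjop (H1 ⊗ H2)%type.
  rewrite {1}/phase P_perp_tensr P_Omega_tens scalerDr addrA -!tensopZr.
  by rewrite -tensopDr.
rewrite !twist_phase // !adj_phase !rE !tens_diagM_r.
rewrite -scalerAr mulr1 -scalerAl mul1r.
by rewrite scalerA -normCKC d1 expr1n.
Qed.

End TensorOperators.

(** * The families of lifts satisfy the axioms *)

Section CanonicalLifts.
Context {C : numClosedFieldType}.
Implicit Types (g d : C) (H G : preHilbertType C).

Lemma twist_idem g H (T : adjop H) : circle0 g -> `|g| *: twist g T = twist g T.
Proof. by case=> [->|->]; rewrite ?scale1r // twist0 scaler0. Qed.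

Lemma tensopD_tens H1 H2 (S S' : adjop H1) (T T' : adjop H2) x y :
  (tensop S T + tensop S' T') (x ⊗ y) = S x ⊗ T y + S' x ⊗ T' y.
Proof. by rewrite adjopDE !tensop_tens. Qed.

Lemma lambda_lift_tens g H1 H2 (X : adjop H1) (x : H1) (y : H2) :
  lambda_lift g H1 H2 X (x ⊗ y)
    = X x ⊗ P_Omega y + twist g X x ⊗ P_perp y.
Proof. by rewrite adjopDE !tensop_tens. Qed.

Lemma rho_lift_tens g H1 H2 (Y : adjop H2) (x : H1) (y : H2) :
  rho_lift g H1 H2 Y (x ⊗ y) = P_Omega x ⊗ Y y + P_perp x ⊗ twist g Y y.
Proof. by rewrite adjopDE !tensop_tens. Qed.

Lemma P_perp_tens_tensl H1 H2 (x : H1) (y : H2) :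
  P_perp (x ⊗ y) = P_perp x ⊗ P_Omega y + x ⊗ P_perp y.
Proof. by rewrite P_perp_tensl adjopDE !tensop_tens. Qed.

Lemma P_perp_tens_tensr H1 H2 (x : H1) (y : H2) :
  P_perp (x ⊗ y) = P_Omega x ⊗ P_perp y + P_perp x ⊗ y.
Proof. by rewrite P_perp_tensr adjopDE !tensop_tens. Qed.

Lemma P_Omega_tensE H1 H2 (x : H1) (y : H2) :
  P_Omega (x ⊗ y) = P_Omega x ⊗ P_Omega y.
Proof. by rewrite P_Omega_tens tensop_tens. Qed.

Lemma adjop_add H (T : adjop H) x y : T (x + y) = T x + T y.
Proof. exact: linearD. Qed.

Lemma tassocD H1 H2 H3 (f g : ((H1 ⊗ H2) ⊗ H3)%type) :
  tassoc (f + g) = tassoc f + tassoc g.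
Proof. exact: linearD. Qed.

Lemma tassoc_ext H1 H2 H3 (S : adjop ((H1 ⊗ H2) ⊗ H3)%type)
    (T : adjop (H1 ⊗ (H2 ⊗ H3))%type) :
  (forall x y z, tassoc (S ((x ⊗ y) ⊗ z)) = T (x ⊗ (y ⊗ z))) ->
  forall v, tassoc (S v) = T (tassoc v).
Proof.
move=> ST v; elim/(@tensor3_ind _ H1 H2 H3): v => [|f g hf hg|x y z].
- by rewrite !linear0.
- by rewrite [S _]adjop_add ![tassoc (_ + _)]tassocD hf hg adjop_add.
- by rewrite ST tassoc_tens.
Qed.

Lemma tmap_comm H1 H2 G1 G2 (W1 : {linear H1 -> G1}) (W2 : {linear H2 -> G2})
    (S : adjop (H1 ⊗ H2)%type) (T : adjop (G1 ⊗ G2)%type) :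
  (forall x y, tmap W1 W2 (S (x ⊗ y)) = T (W1 x ⊗ W2 y)) ->
  forall v, tmap W1 W2 (S v) = T (tmap W1 W2 v).
Proof.
move=> ST; apply: (tensor_ext (f := tmap W1 W2 \o S) (g := T \o tmap W1 W2)).
by move=> x y /=; rewrite ST tmap_tens.
Qed.

Lemma left_universal_lift_lambda g :
  circle0 g -> left_universal_lift (lambda_lift g).
Proof.
move=> gP; split.
- move=> H1 H2; split=> [a S T|S T|T].
  + rewrite /lambda_lift twist_linear // 2!tensopDl 2!tensopZl scalerDr.
    by rewrite addrACA.
  + by rewrite /lambda_lift twistM // tens_diagM_l.
  + by rewrite /lambda_lift adjD !adj_tensop twist_adj // adj_P_Omega P_perp_sa.
- move=> H1 H2 H3 T; apply: tassoc_ext => x y z.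
  (* The twist of the inner lift has the same component [twist g T] over [P_Omega] and over
     [P_perp], so it collapses to [twist g T ⊗ 1]. The splitting of [P_perp] on [H2 ⊗ H3] then
     matches the two sides. *)
  rewrite lambda_lift_tens twist_tensl // twist_idem // -tensopDr P_OmegaD.
  rewrite tensop_tens !lambda_lift_tens tensDl 2!tassocD !tassoc_tens.
  rewrite P_Omega_tensE P_perp_tens_tensl (tensDr (twist g T x)).
  by rewrite addrA.
- move=> H1 H2 G1 G2 T S W1 W2 a1 a2 WT _; apply: tmap_comm => x y.
  rewrite !lambda_lift_tens linearD /= !tmap_tens WT (arrow_twist a1 gP WT).
  by rewrite arrow_P_Omega // arrow_P_perp.
- move=> H1 H2 T x.
  by rewrite lambda_lift_tens P_Omega_Omega P_perp_Omega tens0r addr0.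
Qed.

Lemma right_universal_lift_rho g :
  circle0 g -> right_universal_lift (rho_lift g).
Proof.
move=> gP; split.
- move=> H1 H2; split=> [a S T|S T|T].
  + rewrite /rho_lift twist_linear // 2!tensopDr 2!tensopZr scalerDr.
    by rewrite addrACA.
  + by rewrite /rho_lift twistM // tens_diagM_r.
  + by rewrite /rho_lift adjD !adj_tensop twist_adj // adj_P_Omega P_perp_sa.
- move=> H1 H2 H3 T; apply: tassoc_ext => x y z.
  (* As for left lifts, the twist of the inner lift collapses, here to [1 ⊗ twist g T]. *)
  rewrite [RHS]rho_lift_tens twist_tensr // twist_idem // -tensopDl P_OmegaD.
  rewrite tensop_tens !rho_lift_tens P_Omega_tensE P_perp_tens_tensr.
  rewrite (tensDl (P_Omega x ⊗ _)) 2!tassocD !tassoc_tens [in RHS]tensDr.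
  by rewrite addrA.
- move=> H1 H2 G1 G2 T S W1 W2 a1 a2 WT _; apply: tmap_comm => x y.
  rewrite !rho_lift_tens linearD /= !tmap_tens WT (arrow_twist a2 gP WT).
  by rewrite arrow_P_Omega // arrow_P_perp.
- move=> H1 H2 T x.
  by rewrite rho_lift_tens P_Omega_Omega P_perp_Omega tens0l addr0.
Qed.

(* The defect of middle associativity, with both sides moved so that no
   subtraction occurs. *)
Lemma lambda_rho_assoc g d H1 H2 H3 (T : adjop H2) (x : H1) (y : H2) (z : H3) :
    circle0 g -> circle0 d ->
  tassoc (lambda_lift g _ H3 (rho_lift d H1 H2 T) ((x ⊗ y) ⊗ z))
    + P_perp x ⊗ (`|d| *: twist g T y ⊗ P_perp z)
  = rho_lift d H1 _ (lambda_lift g H2 H3 T) (x ⊗ (y ⊗ z))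
    + P_perp x ⊗ (`|g| *: twist d T y ⊗ P_perp z).
Proof.
move=> gP dP; rewrite lambda_lift_tens [in RHS]rho_lift_tens.
rewrite twist_tensl // twist_tensr // !tensopD_tens.
move: (P_perp x) (P_perp z) (twist g T) (twist d T) => x' z' Tg Td.
rewrite !(tensDl, tensDr) 3!tassocD !tassoc_tens !adjopZE.
move: (_ ⊗ (T y ⊗ _)) (_ ⊗ (Td y ⊗ _)) => a b.
rewrite -!addrA; congr (_ + _); rewrite [RHS]addrCA; do 2!congr (_ + _).
exact: addrC.
Qed.

End CanonicalLifts.

(** * Finite-dimensional test spaces and the arrows out of them *)

Section Euclid.
Variable C : numClosedFieldType.

(** The successor leaves room for [Omega], the basis vector of index [ord0]. The test spaces below
    are [euclid 0], [euclid 1] and [euclid 2], of dimensions one, two and three. *)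
Definition euclid n := 'rV[C]_n.+1.
HB.instance Definition _ n := GRing.Lmodule.copy (euclid n) 'rV[C]_n.+1.

Section Structure.
Variable n : nat.
Implicit Types x y : euclid n.

Definition euclid_inner x y : C := \sum_i (x 0 i)^* * y 0 i.
Definition euclid_delta (i : 'I_n.+1) : euclid n := delta_mx 0 i.

Fact euclid_inner_scalar x : scalar (euclid_inner x).
Proof.
move=> a y z; rewrite /euclid_inner mulr_sumr -big_split /=.
by apply: eq_bigr => i _; rewrite !mxE mulrDr mulrCA.
Qed.

Fact euclid_inner_conj x y : euclid_inner y x = (euclid_inner x y)^*.
Proof.
rewrite /euclid_inner rmorph_sum; apply: eq_bigr => i _ /=.
by rewrite rmorphM /= conjCK mulrC.
Qed.

Fact euclid_inner_gt0 x : x != 0 -> 0 < euclid_inner x x.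
Proof.
have ge0 i : 0 <= (x 0 i)^* * x 0 i by rewrite mulrC mul_conjC_ge0.
rewrite lt0r sumr_ge0 // andbT; apply: contra_neq => /eqP.
rewrite psumr_eq0 // => /allP x0; apply/rowP => i; rewrite mxE; apply/eqP.
by have := x0 i (mem_index_enum i); rewrite mulrC mul_conjC_eq0.
Qed.

Fact euclid_inner_deltal i x : euclid_inner (euclid_delta i) x = x 0 i.
Proof.
rewrite /euclid_inner (bigD1 i) //= big1 => [|k /negPf ki].
  by rewrite mxE !eqxx conjC1 mul1r addr0.
by rewrite mxE ki andbF conjC0 mul0r.
Qed.

Fact euclid_inner_Omega :
  euclid_inner (euclid_delta ord0) (euclid_delta ord0) = 1.
Proof. by rewrite euclid_inner_deltal mxE !eqxx. Qed.

HB.instance Definition _ := isPreHilbert.Build C (euclid n)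
  euclid_inner_scalar euclid_inner_conj euclid_inner_gt0
  euclid_inner_Omega.

Lemma inner_deltal i x : '[euclid_delta i, x] = x 0 i.
Proof. exact: euclid_inner_deltal. Qed.

Lemma inner_delta i j : '[euclid_delta i, euclid_delta j] = (i == j)%:R.
Proof. by rewrite inner_deltal mxE eqxx eq_sym. Qed.

Lemma euclid_sum_delta x : x = \sum_i '[euclid_delta i, x] *: euclid_delta i.
Proof.
by rewrite [LHS]row_sum_delta; apply: eq_bigr => i _; rewrite inner_deltal.
Qed.

Lemma euclid_Omega : Omega = euclid_delta ord0.
Proof. by []. Qed.

End Structure.

Section Frame.
Variables (n : nat) (H : preHilbertType C) (e : 'I_n.+1 -> H).

(** When [e] is orthonormal and starts with [Omega], this is an arrow; it transports facts from a
    test space to an arbitrary [H]. *)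
Definition frame (x : euclid n) : H := \sum_i x 0 i *: e i.

Fact frame_linear : linear frame.
Proof.
move=> a x y; rewrite /frame scaler_sumr -big_split /=.
by apply: eq_bigr => i _; rewrite !mxE scalerDl scalerA.
Qed.
HB.instance Definition _ :=
  GRing.isLinear.Build C (euclid n) H *:%R frame frame_linear.

Lemma frame_delta i : frame (euclid_delta i) = e i.
Proof.
rewrite /frame (bigD1 i) //= big1 => [|k /negPf ki].
  by rewrite !mxE !eqxx scale1r addr0.
by rewrite !mxE ki andbF scale0r.
Qed.

Lemma frame_arrow : (forall i j, '[e i, e j] = (i == j)%:R) -> e ord0 = Omega ->
  is_arrow frame.
Proof.
move=> eo e0; split=> [x y|]; last exact: etrans (frame_delta ord0) e0.
rewrite /= /frame inner_suml; apply: eq_bigr => i _.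
rewrite innerZl inner_sumr (bigD1 i) //= big1 => [|k /negPf ki].
  by rewrite innerZr eo eqxx mulr1 addr0.
by rewrite innerZr eo eq_sym ki mulr0.
Qed.

End Frame.

Definition unit_frame (H : preHilbertType C) (y : H) : euclid 1 -> H :=
  frame (fun i : 'I_2 => if i == ord0 then Omega else y).
HB.instance Definition _ (H : preHilbertType C) (y : H) :=
  GRing.Linear.on (@unit_frame H y).

Definition unit_vec : euclid 1 := @euclid_delta 1 ord_max.

Lemma inner_Omega_unit_vec : '[Omega, unit_vec] = 0.
Proof. exact: inner_delta. Qed.
Lemma inner_unit_vec : '[unit_vec, unit_vec] = 1.
Proof. exact: inner_delta. Qed.

Lemma unit_frame_vec (H : preHilbertType C) (y : H) :
  unit_frame y unit_vec = y.
Proof. exact: frame_delta. Qed.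

(** Together with [unit_frame_vec] this makes every unit vector orthogonal to [Omega] the image of
    the single model vector [unit_vec] under an arrow. *)
Lemma unit_frame_arrow (H : preHilbertType C) (y : H) :
  '[Omega, y] = 0 -> '[y, y] = 1 -> is_arrow (unit_frame y).
Proof.
move=> Oy yy; have yO : '[y, Omega] = 0 by rewrite inner_conj Oy conjC0.
apply: frame_arrow => // i j.
by case: i j => [[|[|//]] ?] [[|[|//]] ?] //=; rewrite inner_Omega.
Qed.

End Euclid.

(* A family of operators commuting with all arrows is determined by its values
   on the one- and two-dimensional spaces, and the reflection of the latter
   makes it diagonal. *)
Lemma natural_family (C : numClosedFieldType)
    (f : forall H : preHilbertType C, H -> H) :
  (forall H, linear (f H)) ->
  (forall (H G : preHilbertType C) (W : {linear H -> G}), is_arrow W ->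
    forall x, W (f H x) = f G (W x)) ->
  exists a b : C, forall H x, f H x = a *: P_Omega x + b *: P_perp x.
Proof.
move=> fl fn.
have fZ (H : preHilbertType C) a (x : H) : f H (a *: x) = a *: f H x.
  have f0 : f H 0 = 0.
    by have := fl H (-1) 0 0; rewrite scaler0 addr0 scaleN1r addNr.
  by have := fl H a x 0; rewrite f0 !addr0.
have fD (H : preHilbertType C) (x y : H) : f H (x + y) = f H x + f H y.
  by have := fl H 1 x y; rewrite !scale1r.
pose a := (f (euclid C 0) Omega : euclid C 0) 0 0.
pose e : euclid C 1 := unit_vec C.
pose b := (f (euclid C 1) e : euclid C 1) 0 ord_max.
have fO (H : preHilbertType C) : f H Omega = a *: Omega.
  pose W : euclid C 0 -> H := frame (fun=> Omega).
  have aW : is_arrow W.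
    by apply: frame_arrow => // i j; rewrite !ord1 inner_Omega eqxx.
  have := fn _ _ _ aW Omega; rewrite /= aW.2 => <-.
  by rewrite /W /frame big_ord1.
have fe : f (euclid C 1) e = b *: e.
  (* The reflection fixing [Omega] and sending [e] to [- e] is an arrow. Commuting with it forces
     the [Omega] coordinate of [f e] to equal its own negative. *)
  have aR : is_arrow (unit_frame (- e)).
    apply: unit_frame_arrow.
      by rewrite innerNr inner_Omega_unit_vec oppr0.
    by rewrite innerNr innerNl opprK inner_unit_vec.
  have fE : f _ e = (f (euclid C 1) e : euclid C 1) 0 0 *: Omega + b *: e.
    apply/rowP => i; rewrite !mxE.
    case: i => [[|[|//]] p] /=; rewrite ?(mulr1, mulr0, addr0, add0r).
      by congr (fun_of_matrix _ _ _); apply: val_inj.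
    by congr (fun_of_matrix _ _ _); apply: val_inj.
  set be := fun_of_matrix _ _ _ in fE.
  have := fn _ _ _ aR e; rewrite /= unit_frame_vec.
  have -> : f _ (- e) = - f _ e by rewrite -[- e]scaleN1r fZ scaleN1r.
  rewrite {}fE.
  rewrite [unit_frame _ _]linearD !linearZ_LR /= aR.2 unit_frame_vec opprD.
  rewrite scalerN.
  move=> /addIr /(congr1 (inner Omega)); rewrite innerNr !innerZr inner_Omega.
  move=> /eqP; rewrite !mulr1 -subr_eq0 opprK -mulr2n mulrn_eq0 /= => /eqP ->.
  by rewrite scale0r add0r.
have fy (H : preHilbertType C) (y : H) : '[Omega, y] = 0 -> f H y = b *: y.
  move=> Oy; have [->|y0] := eqVneq y 0.
    by rewrite -(scale0r 0) fZ !scale0r scaler0.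
  (* Normalizing [y] makes it the image of [e] under an arrow, so the scalar [b] found for [e]
     carries over. *)
  pose c := sqrtC '[y, y]; have c0 : c != 0 by rewrite sqrtC_eq0 inner_eq0.
  have cR : c^* = c by rewrite conj_Creal // ger0_real // sqrtC_ge0 inner_ge0.
  pose z := c^-1 *: y; have -> : y = c *: z by rewrite scalerA mulfV ?scale1r.
  have aW : is_arrow (unit_frame z).
    apply: unit_frame_arrow; rewrite ?innerZl innerZr ?Oy ?mulr0 //.
    by rewrite fmorphV /= cR mulrA -invfM -expr2 sqrtCK mulVf // inner_eq0.
  have := fn _ _ _ aW e; rewrite /= fe linearZ_LR /= unit_frame_vec => fz.
  by rewrite fZ -fz scalerA mulrC -scalerA.
exists a, b => H x.
rewrite {1}(P_OmegaDE x) fD {1}P_OmegaE fZ fO fy ?inner_Omega_P_perp //.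
by rewrite P_OmegaE !scalerA mulrC.
Qed.

(** * Partial inner products on a tensor product *)

Section Contractions.
Context {C : numClosedFieldType} {H1 H2 : preHilbertType C}.

(** The map [<u, .> ⊗ id], adjoint to [y |-> u ⊗ y] by [inner_contractl]. *)
Definition contractl (u : H1) : (H1 ⊗ H2)%type -> H2 :=
  tlift (fun x y => '[u, x] *: y).
Definition contractr (w : H2) : (H1 ⊗ H2)%type -> H1 :=
  tlift (fun x y => '[w, y] *: x).

Fact contractl_betal (u : H1) (y : H2) : linear (fun x => '[u, x] *: y).
Proof. by move=> a x x'; rewrite innerDr innerZr scalerDl scalerA. Qed.
Fact contractl_betar (u x : H1) : linear (fun y : H2 => '[u, x] *: y).
Proof. by move=> a y y'; rewrite scalerDr !scalerA mulrC. Qed.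
HB.instance Definition _ u := GRing.isLinear.Build C (tensor H1 H2) H2 *:%R
  (contractl u) (tlift_linear (contractl_betal u) (contractl_betar u)).

Fact contractr_betal (w y : H2) : linear (fun x : H1 => '[w, y] *: x).
Proof. by move=> a x x'; rewrite scalerDr !scalerA mulrC. Qed.
Fact contractr_betar (w : H2) (x : H1) : linear (fun y => '[w, y] *: x).
Proof. by move=> a y y'; rewrite innerDr innerZr scalerDl scalerA. Qed.
HB.instance Definition _ w := GRing.isLinear.Build C (tensor H1 H2) H1 *:%R
  (contractr w) (tlift_linear (contractr_betal w) (contractr_betar w)).

Lemma contractl_tens (u x : H1) (y : H2) : contractl u (x ⊗ y) = '[u, x] *: y.
Proof. exact: tlift_tens (contractl_betal u) (contractl_betar u) x y. Qed.
Lemma contractr_tens (w y : H2) (x : H1) : contractr w (x ⊗ y) = '[w, y] *: x.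
Proof. exact: tlift_tens (contractr_betal w) (contractr_betar w) x y. Qed.

Lemma inner_contractl (u : H1) (y : H2) v : '[y, contractl u v] = '[u ⊗ y, v].
Proof.
rewrite (trepr_sum v) [contractl _ _]linear_sum !inner_sumr.
apply: eq_bigr => p _.
by rewrite /= contractl_tens innerZr inner_tensE.
Qed.
Lemma inner_contractr (x : H1) (w : H2) v : '[x, contractr w v] = '[x ⊗ w, v].
Proof.
rewrite (trepr_sum v) [contractr _ _]linear_sum !inner_sumr.
apply: eq_bigr => p _.
by rewrite /= contractr_tens innerZr inner_tensE mulrC.
Qed.

End Contractions.

(** Contraction touches only the first factor, so it commutes with maps of the second; this makes
    contracted lifts natural in the second factor. *)
Lemma contractl_tmap (C : numClosedFieldType) (H1 H2 G2 : preHilbertType C)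
    (W : {linear H2 -> G2}) (u : H1) v :
  W (contractl u v) = contractl u (tmap (idfun : {linear H1 -> H1}) W v).
Proof.
apply: (tensor_ext (f := W \o contractl u) (g := contractl u \o tmap _ W)).
by move=> x y /=; rewrite tmap_tens !contractl_tens linearZ.
Qed.

(** * Natural families of *-homomorphisms *)

Lemma natural_star_hom (C : numClosedFieldType)
    (k : forall H : preHilbertType C, adjop H -> adjop H) :
    (forall H, star_hom (k H)) ->
    (forall (H G : preHilbertType C) (T : adjop H) (S : adjop G)
        (W : {linear H -> G}), is_arrow W ->
      (forall x, W (T x) = S (W x)) -> (forall x, W (T^† x) = S^† (W x)) ->
      forall x, W (k H T x) = k G S (W x)) ->
  exists2 g, circle0 g & forall H (T : adjop H), k H T = twist g T.
Proof.
move=> khom knat.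
have kZD (H : preHilbertType C) a (S T : adjop H) :
    k H (a *: S + T) = a *: k H S + k H T.
  by case: (khom H) => + _ _; exact.
have kM (H : preHilbertType C) (S T : adjop H) : k H (S * T) = k H S * k H T.
  by case: (khom H) => _ + _; exact.
have kadj (H : preHilbertType C) (T : adjop H) : k H T^† = (k H T)^†.
  by case: (khom H) => _ _; exact.
have kkb (H : preHilbertType C) (u v v' w : H) :
    k H (ketbra u v) * k H (ketbra v' w) = k H ('[v, v'] *: ketbra u w).
  by rewrite -kM ketbra_mul.
have k0 (H : preHilbertType C) : k H 0 = 0.
  by have := kZD H (-1) 0 0; rewrite scaler0 addr0 scaleN1r addNr.
have [a [b kP]] : exists a b : C, forall (H : preHilbertType C) (x : H),
    k H P_Omega x = a *: P_Omega x + b *: P_perp x.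
  apply: natural_family => [H c x y|H G W aW x]; first exact: adjop_linear.
  by apply: knat => // y; rewrite ?adj_P_Omega arrow_P_Omega.
have kPO (H : preHilbertType C) : k H P_Omega Omega = a *: Omega.
  by rewrite kP P_Omega_Omega P_perp_Omega scaler0 addr0.
have kPv (H : preHilbertType C) (y : H) :
    '[Omega, y] = 0 -> k H P_Omega y = b *: y.
  by move=> Oy; rewrite kP P_Omega_perp // P_perp_id // scaler0 add0r.
have kPP (H : preHilbertType C) : k H P_Omega * k H P_Omega = k H P_Omega.
  by rewrite -kM P_OmegaK.
pose e : euclid C 1 := unit_vec C.
have Oe : '[Omega, e] = 0 by exact: inner_Omega_unit_vec.
have ee : '[e, e] = 1 by exact: inner_unit_vec.
(* Since [k P_Omega] is idempotent, its eigenvalues [a] at [Omega] and [b] at [e] are too. *)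
have aa : a = 0 \/ a = 1.
  have := congr1 (fun T : adjop _ => '[Omega, T Omega]) (kPP (euclid C 1)).
  rewrite adjopME !kPO linearZ_LR /= kPO !innerZr inner_Omega mulr1.
  move/eqP; rewrite -subr_eq0 -{3}[a]mulr1 -mulrBr mulf_eq0 subr_eq0.
  by case/orP => /eqP; [left|right].
have bb : b = 0 \/ b = 1.
  have := congr1 (fun T : adjop _ => '[e, T e]) (kPP (euclid C 1)).
  rewrite adjopME (kPv _ e Oe) linearZ_LR /= (kPv _ e Oe) !innerZr ee mulr1.
  move/eqP; rewrite -subr_eq0 -{3}[b]mulr1 -mulrBr mulf_eq0 subr_eq0.
  by case/orP => /eqP; [left|right].
have b0 : b = 0.
  case: bb => // b1.
  (* With three dimensions, two orthogonal rank-one projections orthogonal to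
     P_Omega would have orthogonal nonzero images in the line of Omega. *)
  pose d (i : 'I_3) : euclid C 2 := euclid_delta C i.
  pose K i := k _ (ketbra (d i) (d i)).
  have Od i : i != ord0 -> '[Omega, d i] = 0.
    by move=> /negPf i0; rewrite euclid_Omega inner_delta eq_sym i0.
  have dO i : i != ord0 -> '[d i, Omega] = 0.
    by move=> i0; rewrite inner_conj Od // conjC0.
  (* Both products of [K i] with [k P_Omega] vanish. As [b = 1], the latter is the identity on the
     complement of [Omega], so [K i] kills this complement and takes values in the line of
     [Omega]. *)
  have KE i : i != ord0 -> exists c, K i = c *: P_Omega.
    move=> i0; exists '[Omega, K i Omega].
    have KX : K i * k _ P_Omega = 0 by rewrite kkb dO // scale0r k0.
    have XK : k _ P_Omega * K i = 0 by rewrite kkb Od // scale0r k0.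
    have Kv y : '[Omega, y] = 0 -> K i y = 0.
      by move=> Oy; rewrite -[y]scale1r -b1 -kPv // -adjopME KX.
    have KO : K i Omega = '[Omega, K i Omega] *: Omega.
      set w := K i Omega.
      have Pw : P_perp w = 0.
        have -> : P_perp w = P_perp (k _ P_Omega w).
          rewrite kP b1 scale1r -adjopZE -adjopDE -adjopME mulrDr -scalerAr.
          by rewrite !PE scaler0 add0r.
        by rewrite /w -[k _ _ (K _ _)]adjopME XK adjop0E linear0.
      by rewrite {1}(P_OmegaDE w) Pw addr0.
    apply: adjop_eq => x; rewrite {1}(P_OmegaDE x) adjop_add.
    rewrite (Kv _ (inner_Omega_P_perp x)) addr0 P_OmegaE linearZ_LR /= {1}KO.
    by rewrite !scalerA mulrC.
  (* [P_Omega] factors through [ketbra (d i) (d i)], so [K i = 0] would give [k P_Omega = 0],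
     against [b = 1]. *)
  have K0 i : i != ord0 -> K i != 0.
    move=> i0; apply/eqP => Ki0.
    have X0 : k (euclid C 2) P_Omega = 0.
      have dd : '[d i, d i] = 1 by rewrite inner_delta eqxx.
      rewrite -[P_Omega]scale1r -dd -kkb -[ketbra Omega (d i)]scale1r -dd -kkb.
      by rewrite -/(K i) Ki0 mulr0 mul0r.
    have := kPv _ (d i) (Od i i0); rewrite X0 b1 scale1r => /esym di0.
    have /eqP := inner_delta C i i; rewrite -[euclid_delta C i]/(d i) di0.
    by rewrite inner0r eqxx eq_sym oner_eq0.
  have [i1 [i2 [i10 i20 i12]]] : exists i1 i2 : 'I_3,
      [/\ i1 != ord0, i2 != ord0 & i1 != i2].
    by exists (inord 1), (inord 2); rewrite -!val_eqE /= !inordK.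
  (* The product [K i1 * K i2] is zero by orthogonality, yet it is a product of nonzero multiples of
     the idempotent [P_Omega]. *)
  have := kkb _ (d i1) (d i1) (d i2) (d i2).
  rewrite inner_delta (negPf i12) scale0r k0 -/(K i1) -/(K i2).
  have := (K0 i1 i10, K0 i2 i20).
  have [[c1 ->] [c2 ->]] := (KE i1 i10, KE i2 i20) => -[n1 n2].
  rewrite -scalerAl -scalerAr P_OmegaK scalerA.
  have /negPf P0 : P_Omega != 0 :> adjop (euclid C 2).
    apply/eqP => P0; have := P_Omega_Omega (H := euclid C 2).
    by rewrite P0 => /esym/eqP; rewrite -inner_eq0 inner_Omega oner_eq0.
  move=> /eqP; rewrite scaler_eq0 P0 orbF mulf_eq0.
  by move: n1 n2; rewrite !scaler_eq0 P0 !orbF => /negPf -> /negPf ->.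
have {}kP (H : preHilbertType C) : k H P_Omega = a *: P_Omega.
  by apply: adjop_eq => x; rewrite kP b0 scale0r addr0.
case: aa => [a0|a1].
  exists 0; first by right.
  (* Every rank-one operator factors through [P_Omega] as [ketbra u Omega * P_Omega * ketbra Omega
     v]. *)
  have kk (H : preHilbertType C) (u v : H) : k H (ketbra u v) = 0.
    rewrite -[ketbra u v]scale1r -(inner_Omega (s := H)) -kkb.
    rewrite -[ketbra Omega v]scale1r -(inner_Omega (s := H)) -kkb.
    by rewrite [k H (ketbra Omega Omega)]kP a0 scale0r mul0r mulr0.
  have [a' [b' k1]] : exists a b : C, forall (H : preHilbertType C) (x : H),
      k H 1 x = a *: P_Omega x + b *: P_perp x.
    apply: natural_family => [H c x y|H G W aW x]; first exact: adjop_linear.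
    by apply: knat => // y; rewrite !adj_op1.
  (* In dimension two the identity is a sum of two rank-one operators. This determines the universal
     scalars of [k 1], hence [k 1 = 0] on every space. *)
  have k10 : k (euclid C 1) 1 = 0.
    have -> : 1 = 1 *: P_Omega + ketbra e e :> adjop (euclid C 1).
      rewrite scale1r; apply: adjop_eq => x; rewrite [LHS]euclid_sum_delta.
      by rewrite big_ord_recl big_ord1 /= euclid_Omega; congr (_ + _ *: _).
    by rewrite kZD !kk scaler0 addr0.
  have a'0 : a' = 0.
    have := congr1 (fun T : adjop _ => '[Omega, T Omega]) k10.
    rewrite k1 P_Omega_Omega P_perp_Omega scaler0 addr0 innerZr inner_Omega.
    by rewrite mulr1 inner0r.
  have b'0 : b' = 0.
    have := congr1 (fun T : adjop _ => '[e, T e]) k10.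
    rewrite k1 P_Omega_perp // P_perp_id // scaler0 add0r innerZr ee.
    by rewrite mulr1 inner0r.
  move=> H T; rewrite twist0 -[T]mul1r kM.
  suff -> : k H 1 = 0 by rewrite mul0r.
  by apply: adjop_eq => x; rewrite k1 a'0 b'0 !scale0r addr0.
have {}kP (H : preHilbertType C) : k H P_Omega = P_Omega.
  by rewrite kP a1 scale1r.
have [a' [g zE]] : exists a b : C, forall (H : preHilbertType C) (u : H),
    k H (ketbra u Omega) Omega = a *: P_Omega u + b *: P_perp u.
  apply: (natural_family (f := fun (H : preHilbertType C) (u : H) =>
    k H (ketbra u Omega) Omega)).
    by move=> H c x y; rewrite ketbra_linearl kZD.
  move=> H G W aW u; rewrite -{2}aW.2; apply: knat => // x.
    by rewrite arrow_ketbra // aW.2.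
  by rewrite !adj_ketbra arrow_ketbra // aW.2.
have a'1 : a' = 1.
  have := congr1 (inner Omega) (zE (euclid C 1) Omega).
  rewrite [k _ (ketbra Omega Omega)]kP P_Omega_Omega P_perp_Omega scaler0 addr0.
  by rewrite innerZr inner_Omega mulr1.
have {}zE (H : preHilbertType C) (u : H) :
    k H (ketbra u Omega) Omega = phase g u.
  by rewrite zE a'1 scale1r.
have g1 : `|g| = 1.
  have ze : k (euclid C 1) (ketbra e Omega) Omega = g *: e.
    by rewrite zE adjopDE adjopZE P_Omega_perp // P_perp_id // add0r.
  (* Moving one factor across by the adjoint turns the left side into the expectation at [Omega] of
     [k] applied to [ketbra Omega e * ketbra e Omega], that is, of [k P_Omega = P_Omega]. *)
  have : '[g *: e, g *: e] = 1.
    rewrite -ze -adjP -kadj adj_ketbra -adjopME kkb ee scale1r.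
    by rewrite [k _ (ketbra _ _)]kP P_Omega_Omega inner_Omega.
  rewrite innerZl innerZr ee mulr1 -normCKC => /eqP.
  by rewrite sqrp_eq1 ?normr_ge0 // => /eqP.
exists g; first by left.
move=> H T; rewrite twist_phase // adj_phase.
(* Apply [k] to [T * ketbra u Omega = ketbra (T u) Omega] and evaluate at [Omega]. Since [phase g]
   is unitary, the resulting intertwining relation determines [k H T]. *)
have -> : phase g * T = k H T * phase g.
  apply: adjop_eq => u; rewrite !adjopME -!zE -adjopME -kM.
  by rewrite mul_ketbra.
by rewrite -mulrA phaseK // mulr1.
Qed.

(** * Exchange of the tensor factors *)

Section Swap.
Context {C : numClosedFieldType}.
Implicit Types H G : preHilbertType C.

Definition tswap {H1 H2} : tensor H1 H2 -> tensor H2 H1 :=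
  tlift (fun x y => y ⊗ x).

HB.instance Definition _ H1 H2 :=
  GRing.isLinear.Build C (tensor H1 H2) (tensor H2 H1) *:%R tswap
    (tlift_linear (fun y => tens_linearr y) (fun x => tens_linearl x)).

Lemma tswap_tens H1 H2 (x : H1) (y : H2) : tswap (x ⊗ y) = y ⊗ x.
Proof.
exact: (tlift_tens (fun y => tens_linearr y) (fun x => tens_linearl x)).
Qed.

Lemma tswapK H1 H2 : cancel (@tswap H1 H2) tswap.
Proof.
apply: (tensor_ext (f := tswap \o tswap) (g := idfun)) => x y.
by rewrite /= !tswap_tens.
Qed.

Lemma inner_tswap H1 H2 (f : tensor H1 H2) g : '[tswap f, g] = '[f, tswap g].
Proof.
rewrite (trepr_sum f) (trepr_sum g) ![tswap _]linear_sum !inner_suml.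
apply: eq_bigr => p _; rewrite !inner_sumr; apply: eq_bigr => q _.
by rewrite /= !tswap_tens !inner_tensE mulrC.
Qed.

Lemma tmap_tswap H1 H2 G1 G2 (W1 : {linear H1 -> G1})
    (W2 : {linear H2 -> G2}) v :
  tmap W2 W1 (tswap v) = tswap (tmap W1 W2 v).
Proof.
move: v; apply: (tensor_ext (f := tmap W2 W1 \o tswap)
  (g := tswap \o tmap W1 W2)).
by move=> x y /=; rewrite !(tmap_tens, tswap_tens).
Qed.

Section Conjugation.
Context {H1 H2 : preHilbertType C}.
Implicit Type X : adjop (tensor H2 H1).

Fact swap_op_linear X : linear (fun v : tensor H1 H2 => tswap (X (tswap v))).
Proof. by move=> a u v; rewrite !linearP. Qed.
Fact swap_op_adj X : exists X' : tensor H1 H2 -> tensor H1 H2,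
  forall u v, '[X' u, v] = '[u, tswap (X (tswap v))].
Proof.
exists (fun v => tswap (X^† (tswap v))) => u v.
by rewrite inner_tswap adjP inner_tswap.
Qed.
Definition swap_op X : adjop (tensor H1 H2) :=
  AdjOp (swap_op_linear X) (swap_op_adj X).

Lemma swap_opE X v : swap_op X v = tswap (X (tswap v)).
Proof. by []. Qed.

Lemma swap_op_star_hom : star_hom swap_op.
Proof.
split=> [a X Y|X Y|X].
- by apply: adjop_eq => v; rewrite adjopDE adjopZE !swap_opE linearP.
- by apply: adjop_eq => v; rewrite adjopME !swap_opE tswapK.
- apply/esym/adj_unique => u v.
  by rewrite !swap_opE inner_tswap adjP inner_tswap.
Qed.

End Conjugation.

Lemma swap_opK H1 H2 : cancel (@swap_op H1 H2) swap_op.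
Proof. by move=> X; apply: adjop_eq => v; rewrite !swap_opE !tswapK. Qed.

(** Reduces the classification of right lifts to that of left lifts. *)
Lemma swap_lambda_lift g H1 H2 (Y : adjop H2) :
  swap_op (lambda_lift g H2 H1 Y) = rho_lift g H1 H2 Y.
Proof.
apply: adjop_tens_eq => x y; rewrite swap_opE tswap_tens lambda_lift_tens.
by rewrite rho_lift_tens linearD /= !tswap_tens.
Qed.

End Swap.

(** * Classification of left, right and two-sided lifts *)

Lemma left_family_classification (C : numClosedFieldType)
    (lam : left_family C) :
    (forall H1 H2, star_hom (lam H1 H2)) ->
    (forall (H1 H2 G1 G2 : preHilbertType C) (T : adjop H1) (S : adjop G1)
        (W1 : {linear H1 -> G1}) (W2 : {linear H2 -> G2}),
      is_arrow W1 -> is_arrow W2 ->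
      (forall x, W1 (T x) = S (W1 x)) ->
      (forall x, W1 (T^† x) = S^† (W1 x)) ->
      forall v, tmap W1 W2 (lam H1 H2 T v) = lam G1 G2 S (tmap W1 W2 v)) ->
    (forall H1 H2 (T : adjop H1) x,
      lam H1 H2 T (x ⊗ Omega) = T x ⊗ Omega) ->
  exists2 g, circle0 g & lam = lambda_lift g.
Proof.
move=> lhom luniv lrestr.
have ladj H1 H2 (T : adjop H1) : lam H1 H2 T^† = (lam H1 H2 T)^†.
  by case: (lhom H1 H2) => _ _; exact.
pose e : euclid C 1 := unit_vec C.
have Oe : '[Omega, e] = 0 by exact: inner_Omega_unit_vec.
have ee : '[e, e] = 1 by exact: inner_unit_vec.
(* The compression of the lift of [T] to [H ⊗ e]; its adjoint is the compression of the lift of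
   [T^†]. *)
pose kf (H : preHilbertType C) (T : adjop H) x :=
  contractr e (lam H (euclid C 1) T (x ⊗ e)).
have kfl (H : preHilbertType C) (T : adjop H) : linear (kf H T).
  by move=> a x y; rewrite /kf tens_linearl !linearP.
have kfa (H : preHilbertType C) (T : adjop H) x y :
    '[kf H T^† x, y] = '[x, kf H T y].
  rewrite inner_contractr inner_conj inner_contractr ladj -inner_conj.
  by rewrite adjP.
pose k H (T : adjop H) := AdjOp (kfl H T) (ex_intro _ (kf H T^†) (kfa H T)).
have lamE (H1 H2 : preHilbertType C) (T : adjop H1) (x : H1) (y : H2) :
    lam H1 H2 T (x ⊗ y) = T x ⊗ P_Omega y + k H1 T x ⊗ P_perp y.
  apply: tensor_eq => u w.
  (* With [u], [T] and [x] fixed, this family is natural in [H]: universality is used with the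
     identity on the first factor. Testing at [Omega] gives [a] by restriction; testing at [e] gives
     [b] by the choice of [k]. *)
  pose f (H : preHilbertType C) (z : H) : H :=
    contractl u (lam H1 H T (x ⊗ z)).
  have [a [b fE]] : exists a b : C, forall (H : preHilbertType C) (z : H),
      f H z = a *: P_Omega z + b *: P_perp z.
    apply: natural_family => [H c z z'|H G W aW z].
      by rewrite /f tens_linearr !linearP.
    by rewrite /f contractl_tmap (luniv _ _ _ _ T T) ?tmap_tens.
  have aE : a = '[u, T x].
    have := congr1 (inner Omega) (fE (euclid C 1) Omega).
    rewrite /f lrestr contractl_tens P_Omega_Omega P_perp_Omega scaler0 addr0.
    by rewrite !innerZr inner_Omega !mulr1 => ->.
  have bE : b = '[u, k H1 T x].
    have := congr1 (inner e) (fE (euclid C 1) e).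
    rewrite /f inner_contractl P_Omega_perp // P_perp_id // scaler0 add0r.
    by rewrite innerZr ee mulr1 inner_contractr => ->.
  rewrite -inner_tens -inner_contractl -[contractl _ _]/(f H2 y) fE aE bE.
  by rewrite innerDr 2!innerZr tensorDE !tensE.
(* The lift leaves [H ⊗ e] invariant, so the compression [k] is a restriction and inherits linearity
   and multiplicativity. *)
have ke (H : preHilbertType C) (T : adjop H) x :
    lam H (euclid C 1) T (x ⊗ e) = k H T x ⊗ e.
  by rewrite lamE P_Omega_perp // P_perp_id // tens0r add0r.
have inje (H : preHilbertType C) (x y : H) : x ⊗ e = y ⊗ e -> x = y.
  exact: tens_injl.
have khom H : star_hom (k H).
  case: (lhom H (euclid C 1)) => ll lM _; split=> [a S T|S T|T].
  - apply: adjop_eq => x; apply: inje.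
    by rewrite -ke ll adjopDE adjopZE !ke adjopDE adjopZE tens_linearl.
  - by apply: adjop_eq => x; apply: inje; rewrite -ke lM !adjopME !ke.
  - by apply/esym/adj_unique => x y; exact: kfa.
have [|g gP kE] := natural_star_hom khom.
  (* Naturality of [k] is universality with the identity of [euclid C 1] as the second arrow. *)
  move=> H G T S W aW WT WT' x; apply: inje.
  have := luniv _ _ _ _ T S W (idfun : {linear euclid C 1 -> euclid C 1}) aW.
  move=> /(_ (conj (fun _ _ => erefl) erefl) WT WT' (x ⊗ e)).
  by rewrite ke !tmap_tens /= ke.
exists g => //; apply: functional_extensionality_dep => H1.
apply: functional_extensionality_dep => H2; apply/funext => T.
apply: adjop_tens_eq => x y.
by rewrite lamE kE lambda_lift_tens.
Qed.

Lemma right_family_classification (C : numClosedFieldType)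
    (rho : right_family C) :
  right_universal_lift rho -> exists2 g, circle0 g & rho = rho_lift g.
Proof.
case=> rhom _ runiv rrestr.
(* Conjugation by the flip turns the right axioms into the left ones and is undone at the end by
   [swap_opK]. *)
pose lam : left_family C := fun H1 H2 T => swap_op (rho H2 H1 T).
have [||H1 H2 T x|g gP lamE] := @left_family_classification C lam.
- move=> H1 H2; have [sl sM sa] := @swap_op_star_hom C H1 H2.
  have [rl rM ra] := rhom H2 H1.
  by split=> [a S T|S T|T]; rewrite /lam ?rl ?sl ?rM ?sM ?ra ?sa.
- move=> H1 H2 G1 G2 T S W1 W2 a1 a2 WT WT' v.
  by rewrite !swap_opE tmap_tswap (runiv _ _ _ _ T S) // tmap_tswap.
- by rewrite swap_opE tswap_tens rrestr tswap_tens.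
exists g => //; apply: functional_extensionality_dep => H1.
apply: functional_extensionality_dep => H2; apply/funext => Y.
rewrite -swap_lambda_lift -lamE.
by rewrite /lam swap_opK.
Qed.

Lemma left_universal_liftP (C : numClosedFieldType) (lam : left_family C) :
  left_universal_lift lam <-> exists2 g, circle0 g & lam = lambda_lift g.
Proof.
split=> [[lhom _ luniv lrestr]|[g gP ->]].
  exact: left_family_classification.
exact: left_universal_lift_lambda.
Qed.

Lemma right_universal_liftP (C : numClosedFieldType) (rho : right_family C) :
  right_universal_lift rho <-> exists2 g, circle0 g & rho = rho_lift g.
Proof.
split=> [|[g gP ->]]; first exact: right_family_classification.
exact: right_universal_lift_rho.
Qed.

Lemma universal_liftP (C : numClosedFieldType) (lam : left_family C)
    (rho : right_family C) :
  universal_lift lam rho <->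
  exists2 p, J_tensor p & lam = lambda_lift p.1 /\ rho = rho_lift p.2.
Proof.
split=> [[/left_universal_liftP[g gP lamE]]|].
  move=> /right_universal_liftP[d dP rhoE] mid.
  exists (g, d) => //; split=> //=; rewrite {}lamE {}rhoE in mid.
  case: (gP) => [g1|->]; last by constructor 2.
  case: (dP) => [d1|->]; last by constructor 3.
  constructor 1.
  (* This [T] has only a column block, so [twist c T Omega = c *: e] recovers the parameter [c]. *)
  pose e := unit_vec C; pose T := ketbra e Omega.
  have Oe : '[Omega, e] = 0 by exact: inner_Omega_unit_vec.
  have ee : '[e, e] = 1 by exact: inner_unit_vec.
  have tE c : `|c| = 1 -> twist c T Omega = c *: e.
    move=> c1; rewrite twist_phase // adj_phase.
    have pO b : phase b Omega = Omega :> euclid C 1.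
      by rewrite adjopDE adjopZE P_Omega_Omega P_perp_Omega scaler0 addr0.
    have TO : T Omega = e by rewrite /= inner_Omega scale1r.
    rewrite !adjopME pO TO.
    by rewrite adjopDE adjopZE P_Omega_perp // P_perp_id // add0r.
  (* Placing [e] in the outer factors keeps both [P_perp] terms alive. Middle associativity cancels
     the rest, and pairing with [e ⊗ (e ⊗ e)] leaves [g = d]. *)
  have := lambda_rho_assoc T e Omega e gP dP.
  rewrite mid tassoc_tens g1 d1 !scale1r !tE // => /addrI.
  move=> /(congr1 (inner (e ⊗ (e ⊗ e)))).
  rewrite P_perp_id // !inner_tensE !innerZr.
  by rewrite !ee !mulr1 !mul1r.
case=> -[g d] /= [gP dP gd] [-> ->]; split.
- exact: left_universal_lift_lambda.
- exact: right_universal_lift_rho.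
move=> H1 H2 H3 T; apply: tassoc_ext => x y z.
have := lambda_rho_assoc T x y z gP dP.
(* Once the two correction terms agree, they cancel; if one parameter is zero, both are zero. *)
suff -> : `|d| *: twist g T y = `|g| *: twist d T y by move=> /addIr.
have {}gd : [\/ g = d, g = 0 | d = 0] := gd.
by case: gd => -> //; rewrite normr0 twist0 scale0r scaler0.
Qed.

Theorem theorem5p4 (R : realType) :
  [/\ forall lam : left_family R[i],
        left_universal_lift lam <->
        exists2 g : R[i], circle0 g & lam = lambda_lift g,
      forall rho : right_family R[i],
        right_universal_lift rho <->
        exists2 g : R[i], circle0 g & rho = rho_lift g
    & forall (lam : left_family R[i]) (rho : right_family R[i]),
        universal_lift lam rho <->
        exists2 p : R[i] * R[i], J_tensor p &
          lam = lambda_lift p.1 /\ rho = rho_lift p.2].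
Proof.
split; [exact: left_universal_liftP | exact: right_universal_liftP |].
exact: universal_liftP.
Qed.
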